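(* Let $(\rho^{(0)},m^{(0)})\in C$, let $(\delta_k)_{k\ge1}$ be weights with $0\le\delta_k\le1$, and let $\{(\rho^{(k)},m^{(k)})\}$, $\{(\hat\rho^{(k)},\hat m^{(k)})\}$ be generated, for $k=1,2,\dots$, by fictitious play: $$(\hat\rho^{(k)},\hat m^{(k)})=\operatorname{argmin}_{(\tilde\rho,\tilde m)\in C}J(\tilde\rho,\tilde m;\rho^{(k-1)}),\qquad (\rho^{(k)},m^{(k)})=(1-\delta_k)(\rho^{(k-1)},m^{(k-1)})+\delta_k(\hat\rho^{(k)},\hat m^{(k)}).$$ Assume that $f$ is $L_f$-Lipschitz in $\rho$, that the terminal cost $f_T(x,\rho_T)=f_T(x)$ is independent of $\rho_T$, that $f$ is monotone, and that there is $\lambda_R>0$ such that, for every $k$, $R$ is directional $\lambda_R$-strongly convex between $(\hat\rho^{(k)},\hat m^{(k)})$ and $(\hat\rho^{(k+1)},\hat m^{(k+1)})$, and between $(\rho^{(k)},m^{(k)})$ and $(\hat\rho^{(k+1)},\hat m^{(k+1)})$. Then, with $c=\frac{2L_f^2}{\lambda_R^2}$, for every $K\ge 1$, $$g(\rho^{(K)},m^{(K)})\le\exp\Big(\sum_{k=1}^K(c\delta_k^2-\delta_k)\Big)g(\rho^{(0)},m^{(0)}).$$ In particular, taking $\delta_k=\frac{\alpha}{k+\alpha}$ with a fixed $\alpha>0$ gives $$g(\rho^{(K)},m^{(K)})\le g(\rho^{(0)},m^{(0)})\,\frac{(\alpha+1)^\alpha\exp(c\alpha)}{(K+\alpha+1)^\alpha},$$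 and taking $\delta_k=\delta\le\min\{1,\frac1c\}$ constant gives $$g(\rho^{(K)},m^{(K)})\le\exp\big(-\delta(1-c\delta)K\big)\,g(\rho^{(0)},m^{(0)}).$$
   Context: **Domain and notation.** Fix $T>0$, $\nu>0$, $\mathbb T^d=\mathbb R^d/\mathbb Z^d$, $Q_T=\mathbb T^d\times(0,T)$. $\langle\cdot,\cdot\rangle_{\mathbb T^d},\|\cdot\|_{\mathbb T^d}$ and $\langle\cdot,\cdot\rangle_{Q_T},\|\cdot\|_{Q_T}$ are the $L^2$ inner products and norms on $\mathbb T^d$ and $Q_T$. $\mathcal P(\mathbb T^d)$ is the set of Borel probability measures on $\mathbb T^d$; an absolutely continuous measure is identified with its density. A density evolution is $\rho=(\rho_t)_{t\in[0,T]}$ with $\rho_t=\rho(\cdot,t)\in\mathcal P(\mathbb T^d)$; $\rho>0$ means the density is positive everywhere. **Standing assumptions on the data.** $\rho_0$ is a probability measure on $\mathbb T^d$ with a $C^2$ positive density. The Hamiltonian $H:\mathbb T^d\times\mathbb R^d\to\mathbb R$, $(x,p)\mapsto H(x,p)$, is $C^2$ in $x$, smooth and strictly convex in $p$, and $\lim_{|p|\to\infty}H(x,p)/|p|=+\infty$ for all $x$. The interaction cost $f$ is either nonlocal, $f:\mathbb T^d\times\mathcal P(\mathbb T^d)\to\mathbb R$ with $f(\cdot,\rho)\in C^2(\mathbb T^d)$ for each $\rho\in\mathcal P(\mathbb T^d)$, or local, $f\in C^2(\mathbb T^d\times[0,\infty))$, in which case $f(x,\rho)$ means $f(x,\rho(x))$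 for a density $\rho$. The terminal cost $f_T$ is likewise nonlocal with $f_T(\cdot,\rho)\in C^3(\mathbb T^d)$, or local with $f_T\in C^3(\mathbb T^d\times[0,\infty))$. For a density evolution $\rho$, $f(\rho)$ is the function $(x,t)\mapsto f(x,\rho_t)$ and $f_T(\rho_T)$ is $x\mapsto f_T(x,\rho_T)$. **Constraint set and costs.** $C$ is the set of $(\rho,m)$ with $\rho\in C([0,T],L^1(\mathbb T^d)\cap\mathcal P(\mathbb T^d))$, $m\in L^1(\mathbb T^d\times[0,T];\mathbb R^d)$, $\rho(\cdot,0)=\rho_0$ and $\partial_t\rho-\nu\Delta\rho+\nabla\cdot m=0$ in the sense of distributions. $L(x,v)=\sup_p\{-\langle p,v\rangle-H(x,p)\}$. The dynamic cost is $R(\rho,m)=\int_0^T\int_{\mathbb T^d}\rho\,L(x,m/\rho)\,dx\,dt$, where for $\rho=0$, $L(x,m/\rho):=0$ if $m=0$ and $+\infty$ if $m\ne0$. For $(\tilde\rho,\tilde m)\in C$ and a density evolution $\rho$, $J(\tilde\rho,\tilde m;\rho)=R(\tilde\rho,\tilde m)+\langle f(\rho),\tilde\rho\rangle_{Q_T}+\langle f_T(\rho_T),\tilde\rho_T\rangle_{\mathbb T^d}$. **Best response.** The best response of $\rho$ (or of $(\rho,m)$) is the unique minimizer $(\hat\rho,\hat m)=\operatorname{argmin}_{(\tilde\rho,\tilde m)\in C}J(\tilde\rho,\tilde m;\rho)$. Well-posedness convention: the density evolutions $\rho$ whose best response is considered (here all iterates $\rho^{(k)}$) are regular enough that the backward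 equation $-\partial_t\hat\phi-\nu\Delta\hat\phi+H(x,\nabla\hat\phi)=f(x,\rho_t)$ in $Q_T$, $\hat\phi(\cdot,T)=f_T(\cdot,\rho_T)$ has a unique classical solution $\hat\phi$ and the forward equation $\partial_t\hat\rho-\nu\Delta\hat\rho-\nabla\cdot(\hat\rho D_pH(x,\nabla\hat\phi))=0$, $\hat\rho(\cdot,0)=\rho_0$ has a unique classical solution, which is positive; the best response exists, is unique, and equals $(\hat\rho,-\hat\rho D_pH(\cdot,\nabla\hat\phi))$. (The paper asserts this as a standard fact when $\rho\in C^2(\overline{Q_T})$, $\rho>0$, $\rho(\cdot,t)\in\mathcal P(\mathbb T^d)$, $\rho(\cdot,0)=\rho_0$, and for all fictitious play iterates started from such a $\rho$.) **Gain of the best response.** For $(\rho,m)\in C$, $g(\rho,m)=J(\rho,m;\rho)-\min_{(\tilde\rho,\tilde m)\in C}J(\tilde\rho,\tilde m;\rho)$. **Monotone.** A nonlocal $f$ is monotone if $\int_{\mathbb T^d}(f(x,\rho)-f(x,\rho'))\,d(\rho-\rho')(x)\ge0$ for all $\rho,\rho'\in\mathcal P(\mathbb T^d)$; a local $f$ is monotone if $f(x,\cdot)$ is nondecreasing for every $x$. **$L_f$-Lipschitz.** If $f$ is nonlocal: $\|f(\cdot,\rho)-f(\cdot,\rho')\|_{\mathbb T^d}\le L_f\|\rho-\rho'\|_{\mathbb T^d}$ for all $\rho,\rho'\in\mathcal P(\mathbb T^d)$; if $f$ is local: $|f(x,\rho)-f(x,\rho')|\le L_f|\rho-\rho'|$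 for all $x\in\mathbb T^d$, $\rho,\rho'\in[0,\infty)$. **Directional strong convexity.** For $(\rho^0,m^0),(\rho^1,m^1)\in C$ let $y(\theta)=R\big((1-\theta)(\rho^0,m^0)+\theta(\rho^1,m^1)\big)$, $\theta\in[0,1]$. $R$ is directional $\lambda_R$-strongly convex between the two pairs if $\lambda_R>0$ and $y$ is $(\lambda_R\|\rho^0-\rho^1\|_{Q_T}^2)$-strongly convex on $[0,1]$ (where $y$ is $\mu$-strongly convex if $y(\theta)-\frac{\mu}{2}\theta^2$ is convex). *)

(* Defs.v *)
(* The torus T^d = R^d/Z^d is handled through its universal cover: a function
   on T^d is a Z^d-periodic function on ['rV[R]_d], and a Borel measure on T^d
   is a Borel measure on ['rV[R]_d] carried by the fundamental domain [0,1)^d.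
   Space-time functions have domain ['rV[R]_d * R]. *)
From HB Require Import structures.
From mathcomp Require Import all_boot all_order all_algebra.
From mathcomp Require Import all_classical all_reals all_analysis.
From mathcomp Require Import measurable_realfun.

Set Implicit Arguments.
Unset Strict Implicit.
Unset Printing Implicit Defensive.

Import Order.TTheory GRing.Theory Num.Theory numFieldNormedType.Exports.

Local Open Scope classical_set_scope.
Local Open Scope ring_scope.

HB.instance Definition _ (R : realType) (m n : nat) :=
  @isMeasurable.Build (sigma_display (@open 'M[R]_(m, n))) 'M[R]_(m, n)
    <<s @open 'M[R]_(m, n) >>
    (@sigma_algebra0 _ setT _) (@sigma_algebraC _ _)
    (@sigma_algebra_bigcup _ setT _).

Section torus_measure.
Variable R : realType.

Definition unit_cube (d : nat) : set 'rV[R]_d :=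
  [set x | forall i, 0 <= x ord0 i < 1].

Definition consp (n : nat) (z : measurableTypeR R * n.-tuple R) :
  n.+1.-tuple R := [tuple of z.1 :: z.2].

Lemma measurable_consp n : measurable_fun setT (@consp n).
Proof. exact: (@measurable_cons _ _ _ R). Qed.

HB.instance Definition _ n :=
  isMeasurableFun.Build _ _ _ _ (@consp n) (@measurable_consp n).

(* The product of n copies of the uniform probability on [0,1]. *)
Fixpoint cube_prob (n : nat) : probability (n.-tuple R) R :=
  match n with
  | 0 => \d_([tuple] : 0.-tuple R)
  | n'.+1 => distribution (uniform_prob (@ltr01 R) \x cube_prob n')%E
               [the {mfun _ >-> n'.+1.-tuple R} of @consp n']
  end.

Definition row_of_tuple (n : nat) (t : n.-tuple R) : 'rV[R]_n :=
  \row_i tnth t i.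

Lemma measurable_row_of_tuple n : measurable_fun setT (@row_of_tuple n).
Proof.
apply: (measurability (@open 'rV[R]_n)) => // _ [A oA <-]; rewrite setTI.
pose c (q : 'rV[rat]_n) : 'rV[R]_n := \row_i ratr (q ord0 i).
pose B (p : 'rV[rat]_n * rat) := ball (c p.1) (ratr p.2 : R).
have -> : A = \bigcup_(p in [set p | B p `<=` A]) B p.
  rewrite eqEsubset; split=> [x Ax|x [p pA /pA//]].
  have [e /= e0 eA] := (nbhs_ballP _ _).1 (open_nbhs_nbhs (conj oA Ax)).
  have /rat_in_itvoo[r] : (0 : R) < e / 2 by rewrite divr_gt0.
  rewrite in_itv/= => /andP[r0 re].
  have /choice[q qP] (i : 'I_n) : exists q : rat,
      ball (ratr q : R) (ratr r) (x ord0 i).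
    have /rat_in_itvoo[q] : x ord0 i - ratr r < x ord0 i.
      by rewrite ltrBlDr ltrDl.
    rewrite in_itv/= => /andP[q1 q2]; exists q.
    by rewrite /ball/= distrC gtr0_norm ?subr_gt0// ltrBlDr -ltrBlDl.
  have xB : B (\row_i q i, r) x.
    by split=> // i j; rewrite !mxE ord1.
  exists (\row_i q i, r) => //= y yB; apply: eA.
  rewrite (splitr e); apply: (ball_triangle (y := c (\row_i q i))).
    by apply: (le_ball (ltW re)); exact/ball_sym.
  exact: (le_ball (ltW re)).
rewrite preimage_bigcup bigcup_mkcond.
apply: countable_bigcupT_measurable => [|p]; first exact: countableP.
case: ifPn => _; last exact: measurable0.
have [r0|r0] := ltP 0 (ratr p.2 : R); last first.
  rewrite (_ : _ @^-1` _ = set0)//.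
  by rewrite -subset0 => t [] /(le_lt_trans r0); rewrite ltxx.
rewrite (_ : _ @^-1` _ = \bigcap_(i in [set: 'I_n])
    ((fun t : n.-tuple R => tnth t i) @^-1`
      ball (ratr (p.1 ord0 i) : R) (ratr p.2))); last first.
  apply/seteqP; split=> [t [_ tB] i _|t tB].
    by have := tB ord0 i; rewrite !mxE.
  by split=> // i j; rewrite !mxE ord1; exact: tB.
apply: fin_bigcap_measurable => [|i _]; first exact: finite_finset.
rewrite -[X in measurable X]setTI; apply: measurable_tnth => //.
by rewrite ball_itv; exact: measurable_itv.
Qed.

HB.instance Definition _ n :=
  isMeasurableFun.Build _ _ _ _ (@row_of_tuple n) (@measurable_row_of_tuple n).

Definition leb d : probability 'rV[R]_d R :=
  distribution (cube_prob d) (@row_of_tuple d).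
Arguments leb : clear implicits.

Lemma cube_prob_unit n :
  cube_prob n [set t | forall i, 0 <= tnth t i < 1] = 1%E.
Proof.
elim: n => [|n IHn] /=; first by rewrite diracE mem_set// => -[].
have mC : measurable [set t : n.-tuple R | forall i, 0 <= tnth t i < 1].
  rewrite (_ : [set t | _] = \bigcap_(i in [set: 'I_n])
      ((fun t : n.-tuple R => tnth t i) @^-1` `[0, 1[%classic)).
    apply: fin_bigcap_measurable => [|i _]; first exact: finite_finset.
    rewrite -[X in measurable X]setTI.
    by apply: (@measurable_tnth _ R n i) => //; exact: measurable_itv.
  apply/seteqP; split=> [t tC i _|t tC i] /=; first by rewrite in_itv/=.
  by have := tC i I; rewrite /= in_itv.
rewrite /distribution /pushforward.
rewrite (_ : _ @^-1` _ = `[0, 1[%classic `*`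
    [set t : n.-tuple R | forall i, 0 <= tnth t i < 1]); last first.
  apply/seteqP; split=> [[x t] xtC|[x t] [/= xC tC] i] /=.
    split=> [|i]; first by have := xtC ord0; rewrite /= in_itv.
    by have := xtC (lift ord0 i); rewrite tnthS.
  case: (unliftP ord0 i) => [j|] ->; first by rewrite tnthS.
  by move: xC; rewrite in_itv.
rewrite product_measure1E//= IHn mule1.
rewrite /uniform_prob integral_uniform_pdf (eq_integral (fun=> 1%:E)).
  rewrite integral_cst//= ?mul1e; last by apply: measurableI; exact: measurable_itv.
  rewrite setIidl ?lebesgue_measure_itv/= ?lte_fin ?ltr01 -?EFinB ?subr0//.
  by move=> x/=; rewrite !in_itv/= => /andP[-> /ltW].
move=> x; rewrite inE/= !in_itv/= => -[_ x01].
by rewrite /uniform_pdf x01 subr0 invr1.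
Qed.

Lemma measurable_unit_cube d : measurable (@unit_cube d).
Proof.
have mO (A : set R) i : open A ->
    measurable ((fun x : 'rV[R]_d => x ord0 i) @^-1` A).
  move=> oA; apply: sub_sigma_algebra; apply: open_comp => // x _.
  exact: coord_continuous.
rewrite (_ : @unit_cube d = \bigcap_(i in [set: 'I_d])
    ((fun x : 'rV[R]_d => x ord0 i) @^-1` [set s | s < 1] `\`
     (fun x : 'rV[R]_d => x ord0 i) @^-1` [set s | s < 0])).
  apply: fin_bigcap_measurable => [|i _]; first exact: finite_finset.
  by apply: measurableD; apply: mO; exact: open_lt.
apply/seteqP; split=> [x xC i _|x xC i] /=.
  by have /andP[x0 x1] := xC i; split=> //; apply/negP; rewrite -leNgt.
by have [/= -> /negP] := xC i I; rewrite -leNgt => ->.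
Qed.

Lemma leb_unit_cube d : leb d (@unit_cube d) = 1%E.
Proof.
rewrite -(cube_prob_unit d) /leb /distribution /pushforward; congr (cube_prob d _).
by apply/seteqP; split=> t tC i; have := tC i; rewrite mxE.
Qed.

End torus_measure.

Section calculus.
Variable R : realType.

(* On a finite-dimensional space [V] this is the usual class C^k. *)
Fixpoint Ck (V : normedModType R) (k : nat) (F : V -> R) : Prop :=
  if k is k'.+1 then
    [/\ continuous F, forall v x, derivable F x v & forall v, Ck k' ('D_v F)]
  else continuous F.

Definition smooth (V : normedModType R) (F : V -> R) := forall k, Ck k F.

Variable d : nat.
Implicit Types (F : 'rV[R]_d * R -> R) (z : 'rV[R]_d * R).

Definition dotp (u v : 'rV[R]_d) : R := \sum_i u ord0 i * v ord0 i.

Definition periodic (T : Type) (G : 'rV[R]_d -> T) :=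
  forall i x, G (x + delta_mx ord0 i) = G x.

Definition slice (T : Type) (G : 'rV[R]_d * R -> T) (t : R) : 'rV[R]_d -> T :=
  fun x => G (x, t).

Definition dir (i : 'I_d) : 'rV[R]_d * R := (delta_mx ord0 i, 0).

Definition dt F z : R := 'D_(0, 1) F z.
Definition grad F z : 'rV[R]_d := \row_i 'D_(dir i) F z.
Definition lap F z : R := \sum_i 'D_(dir i) ('D_(dir i) F) z.
Definition div (G : 'rV[R]_d * R -> 'rV[R]_d) z : R :=
  \sum_i 'D_(dir i) (fun y => G y ord0 i) z.

(* C^{2,1}(T^d x [0,T]), regularity on the closed time interval being
   understood as extendability. *)
Definition C21 (T : R) F :=
  (forall t, 0 <= t <= T -> periodic (slice F t)) /\
  exists2 E : 'rV[R]_d * R -> R,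
    (forall x t, 0 <= t <= T -> E (x, t) = F (x, t)) &
    [/\ continuous E,
        (forall z, derivable E z (0, 1)) /\ continuous (dt E),
        forall i, (forall z, derivable E z (dir i)) /\
                  continuous ('D_(dir i) E) &
        forall i j, (forall z, derivable ('D_(dir i) E) z (dir j)) /\
                    continuous ('D_(dir j) ('D_(dir i) E))].

End calculus.

Section spaces.
Variables (R : realType) (d : nat).

Definition cyl (T : R) : set ('rV[R]_d * R) := setT `*` `]0, T[%classic.
Definition cylbar (T : R) : set ('rV[R]_d * R) := setT `*` `[0, T]%classic.

Definition lebQ := (leb R d \x @lebesgue_measure R)%E.

Definition normT (h : 'rV[R]_d -> R) : \bar R :=
  ('N[leb R d]_2%:E[EFin \o h])%E.
Definition normQ (T : R) (h : 'rV[R]_d * R -> R) : \bar R :=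
  ('N[lebQ]_2%:E[(EFin \o h) \_ (cyl T)])%E.

Definition innerT (g h : 'rV[R]_d -> R) : \bar R :=
  (\int[leb R d]_x (g x * h x)%:E)%E.
Definition innerQ (T : R) (g h : 'rV[R]_d * R -> R) : \bar R :=
  (\int[lebQ]_(z in cyl T) (g z * h z)%:E)%E.

Record torus_prob := TorusProb {
  tprob :> probability 'rV[R]_d R ;
  tprob_cube : tprob (@unit_cube R d) = 1%E }.

Definition leb_prob := TorusProb (leb_unit_cube R d).

Definition is_density (h : 'rV[R]_d -> R) :=
  [/\ periodic h, measurable_fun setT h, forall x, 0 <= h x &
      (\int[leb R d]_x (h x)%:E = 1)%E].

Definition has_density (mu : torus_prob) (h : 'rV[R]_d -> R) :=
  forall A, measurable A -> (mu A = \int[leb R d]_(x in A) (h x)%:E)%E.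

(* The measure with density [h], with a default value if there is none. *)
Definition prob_of_density (h : 'rV[R]_d -> R) : torus_prob :=
  if pselect (exists mu, has_density mu h) is left e then projT1 (cid e)
  else leb_prob.

Section measure_of_density.
Variable h : 'rV[R]_d -> R.

Definition density_measure (_ : is_density h) (A : set 'rV[R]_d) : \bar R :=
  (\int[leb R d]_(x in A) (h x)%:E)%E.

Hypothesis hP : is_density h.
Let densm := density_measure hP.

Let densm0 : densm set0 = 0%E. Proof. exact: integral_set0. Qed.

Let densm_ge0 A : (0 <= densm A)%E.
Proof. by case: hP => _ _ h0 _; apply: integral_ge0 => x _; rewrite lee_fin. Qed.

Let densm_sigma_additive : semi_sigma_additive densm.
Proof.
case: hP => _ mh h0 _ F mF tF mUF; rewrite /densm /density_measure; apply: cvg_toP.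
  apply: ereal_nondecreasing_is_cvgn => m n mn.
  apply: lee_sum_nneg_natr => // k _ _; exact: densm_ge0.
rewrite ge0_integral_bigcup//= => [|x _]; last by rewrite lee_fin.
by apply/measurable_EFinP/measurable_funTS.
Qed.

HB.instance Definition _ := isMeasure.Build _ _ _ (density_measure hP)
  densm0 densm_ge0 densm_sigma_additive.

Let densm_setT : densm setT = 1%E. Proof. by case: hP. Qed.

HB.instance Definition _ :=
  @Measure_isProbability.Build _ _ R (density_measure hP) densm_setT.

Let densm_cube : densm (@unit_cube R d) = 1%E.
Proof.
case: hP => _ mh h0 <-; rewrite /densm /density_measure.
have mC := @measurable_unit_cube R d.
rewrite [RHS](@ge0_negligible_integral _ _ _ (leb R d) _ (~` @unit_cube R d)) //=.
- by rewrite setTD setCK.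
- exact: measurableC.
- exact/measurable_EFinP.
- by move=> x _; rewrite lee_fin.
- have := probability_setC (leb R d) mC.
  by move=> /= ->; rewrite leb_unit_cube subee.
Qed.

Lemma prob_of_densityP : has_density (prob_of_density h) h.
Proof.
rewrite /prob_of_density; case: pselect => [e|[]]; first exact: projT2 (cid e).
by exists (@TorusProb (density_measure hP) densm_cube).
Qed.

End measure_of_density.

(* Elements of C([0,T], L^1(T^d) `&` P(T^d)), through a jointly measurable
   representative with nonnegative time slices. *)
Definition density_evolution (T : R) (r : 'rV[R]_d * R -> R) :=
  [/\ measurable_fun (cylbar T) r,
      forall t, 0 <= t <= T -> is_density (slice r t) &
      forall t, 0 <= t <= T ->
        (\int[leb R d]_x (`|r (x, s) - r (x, t)|)%:E)%E
          @[s --> within `[0, T]%classic (nbhs t)] --> 0%E].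

Definition eq_evolution (T : R) (r r' : 'rV[R]_d * R -> R) :=
  forall t, 0 <= t <= T -> {ae leb R d, forall x, r (x, t) = r' (x, t)}.

Definition L1_momentum (T : R) (m : 'rV[R]_d * R -> 'rV[R]_d) :=
  (forall t, 0 <= t <= T -> periodic (slice m t)) /\
  forall i, lebQ.-integrable (cylbar T) (fun z => (m z ord0 i)%:E).

Definition eq_momentum (T : R) (m m' : 'rV[R]_d * R -> 'rV[R]_d) :=
  {ae lebQ, forall z, cyl T z -> m z = m' z}.

End spaces.
Arguments cyl {R} d T.
Arguments cylbar {R} d T.
Arguments lebQ : clear implicits.

Section couplings.
Variables (R : realType) (d : nat).

Inductive coupling :=
  | Nonlocal of ('rV[R]_d -> torus_prob R d -> R)
  | Local of ('rV[R]_d -> R -> R).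

Implicit Types f : coupling.

(* [coupling_at f h x] is f(x, rho) for the measure rho of density [h]. *)
Definition coupling_at f (h : 'rV[R]_d -> R) (x : 'rV[R]_d) : R :=
  match f with
  | Nonlocal F => F x (prob_of_density h)
  | Local F => F x (h x)
  end.

(* In the local case, C^k(T^d x [0,oo)) is the class of restrictions of C^k
   functions. *)
Definition coupling_Ck (k : nat) f : Prop :=
  match f with
  | Nonlocal F => forall mu, periodic (F^~ mu) /\ Ck k (F^~ mu)
  | Local F => (forall s, 0 <= s -> periodic (F^~ s)) /\
      exists2 G : 'rV[R]_d * R -> R, Ck k G &
        forall x s, 0 <= s -> G (x, s) = F x s
  end.

Definition coupling_monotone f : Prop :=
  match f with
  | Nonlocal F => forall mu mu' : torus_prob R d,
      (0 <= \int[mu]_x (F x mu - F x mu')%:E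
            - \int[mu']_x (F x mu - F x mu')%:E)%E
  | Local F => forall x s s', 0 <= s -> s <= s' -> F x s <= F x s'
  end.

(* In the nonlocal case, ||mu - mu'|| is the L^2 norm of the density of the
   signed measure mu - mu', and +oo if there is no square-integrable one. *)
Definition coupling_lipschitz (Lf : R) f : Prop :=
  match f with
  | Nonlocal F => forall (mu mu' : torus_prob R d) (h : 'rV[R]_d -> R),
      measurable_fun setT h -> (normT h < +oo)%E ->
      (forall A, measurable A ->
         (mu A - mu' A = \int[leb R d]_(x in A) (h x)%:E)%E) ->
      (normT (fun x => F x mu - F x mu')%R <= Lf%:E * normT h)%E
  | Local F => forall x s s', 0 <= s -> 0 <= s' ->
      `|F x s - F x s'| <= Lf * `|s - s'|
  end.

Definition coupling_independent f : Prop :=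
  match f with
  | Nonlocal F => forall x mu mu', F x mu = F x mu'
  | Local F => forall x s s', 0 <= s -> 0 <= s' -> F x s = F x s'
  end.

End couplings.

Section mean_field_game.
Variables (R : realType) (d : nat).

Record mfg := Mfg {
  horizon : R ;
  visc : R ;
  rho0 : 'rV[R]_d -> R ;
  ham : 'rV[R]_d -> 'rV[R]_d -> R ;
  cost : coupling R d ;
  costT : coupling R d }.

Definition superlinear (h : 'rV[R]_d -> R) :=
  forall A : R, exists B : R, forall p, B < `|p| -> A < h p / `|p|.

Definition strictly_convex (h : 'rV[R]_d -> R) :=
  forall p q s, p != q -> 0 < s < 1 ->
    h ((1 - s) *: p + s *: q) < (1 - s) * h p + s * h q.

Definition standing_assumptions (D : mfg) :=
  [/\ 0 < horizon D /\ 0 < visc D,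
      [/\ is_density (rho0 D), Ck 2 (rho0 D) & forall x, 0 < rho0 D x],
      [/\ forall p, periodic ((ham D)^~ p),
          forall p, Ck 2 ((ham D)^~ p),
          forall x, smooth (ham D x),
          forall x, strictly_convex (ham D x) &
          forall x, superlinear (ham D x)],
      coupling_Ck 2 (cost D) &
      coupling_Ck 3 (costT D)].

Variable D : mfg.
Let T := horizon D.
Let nu := visc D.
Let H := ham D.

Implicit Types (r phi : 'rV[R]_d * R -> R) (m : 'rV[R]_d * R -> 'rV[R]_d).

Definition DpH (x p : 'rV[R]_d) : 'rV[R]_d :=
  \row_i 'D_(delta_mx ord0 i : 'rV[R]_d) (H x) p.

Definition test_function (psi : 'rV[R]_d * R -> R) :=
  [/\ smooth psi, forall t, periodic (slice psi t) &
      exists a b, [/\ 0 < a, b < T &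
        forall x t, ~~ (a <= t <= b) -> psi (x, t) = 0]].

(* d_t r - nu Lap r + div m = 0 in the sense of distributions on Q_T *)
Definition continuity_eq r m :=
  forall psi, test_function psi ->
    (\int[lebQ R d]_(z in cyl d T)
       (r z * (dt psi z + nu * lap psi z) + dotp (m z) (grad psi z))%:E = 0)%E.

Definition constraint r m :=
  [/\ density_evolution T r, L1_momentum T m,
      {ae leb R d, forall x, r (x, 0) = rho0 D x} & continuity_eq r m].

Definition lagrangian (x v : 'rV[R]_d) : \bar R :=
  ereal_sup (range (fun p => (- dotp p v - H x p)%:E)).

(* rho L(x, m/rho); the value for rho = 0 <> m is the infinite one and not the
   library's 0 * +oo = 0. *)
Definition dynamic_density (x : 'rV[R]_d) (s : R) (v : 'rV[R]_d) : \bar R :=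
  if s == 0 then (if v == 0 then 0%E else +oo%E)
  else (s%:E * lagrangian x (s^-1 *: v))%E.

Definition dynamic_cost r m : \bar R :=
  (\int[lebQ R d]_(z in cyl d T) dynamic_density z.1 (r z) (m z))%E.

Definition cost_along r (z : 'rV[R]_d * R) : R :=
  coupling_at (cost D) (slice r z.2) z.1.

(* [J r' m' r] is J(r', m'; r). *)
Definition J r' m' r : \bar R :=
  (dynamic_cost r' m' + innerQ T (cost_along r) r'
   + innerT (coupling_at (costT D) (slice r T)) (slice r' T))%E.

Definition minimizer r' m' r :=
  constraint r' m' /\ forall r1 m1, constraint r1 m1 -> (J r' m' r <= J r1 m1 r)%E.

Definition best_response r' m' r :=
  minimizer r' m' r /\
  forall r1 m1, minimizer r1 m1 r -> eq_evolution T r' r1 /\ eq_momentum T m' m1.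

Definition gain r m : \bar R :=
  (J r m r - ereal_inf [set J a.1 a.2 r | a in [set a | constraint a.1 a.2]])%E.

Definition backward_eq r phi :=
  [/\ C21 T phi,
      forall x t, 0 < t < T ->
        - dt phi (x, t) - nu * lap phi (x, t) + H x (grad phi (x, t))
        = cost_along r (x, t) &
      forall x, phi (x, T) = coupling_at (costT D) (slice r T) x].

Definition drift phi r' (z : 'rV[R]_d * R) : 'rV[R]_d :=
  r' z *: DpH z.1 (grad phi z).

Definition forward_eq phi r' :=
  [/\ C21 T r',
      forall x t i, 0 < t < T ->
        derivable (fun z => drift phi r' z ord0 i) (x, t) (dir R i),
      forall x t, 0 < t < T ->
        dt r' (x, t) - nu * lap r' (x, t) - div (drift phi r') (x, t) = 0 &
      forall x, r' (x, 0) = rho0 D x].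

Definition eq_on_cylbar (F G : 'rV[R]_d * R -> R) :=
  forall x t, 0 <= t <= T -> F (x, t) = G (x, t).

(* A density evolution is a class of functions: the backward equation is only
   required to hold pointwise for some representative [r1] of [r]. *)
Definition regular_evolution r :=
  exists2 r1, density_evolution T r1 /\ eq_evolution T r r1 &
  exists phi r',
  [/\ backward_eq r1 phi /\
        (forall phi1, backward_eq r1 phi1 -> eq_on_cylbar phi phi1),
      forward_eq phi r' /\
        (forall r2, forward_eq phi r2 -> eq_on_cylbar r' r2),
      forall x t, 0 <= t <= T -> 0 < r' (x, t) &
      best_response r' (fun z => - drift phi r' z) r].

Definition convex01 (y : R -> \bar R) :=
  forall a b s, 0 <= a <= 1 -> 0 <= b <= 1 -> 0 <= s <= 1 ->
    (y ((1 - s) * a + s * b)%R <= (1 - s)%:E * y a + s%:E * y b)%E.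

Definition strongly_convex01 (mu : R) (y : R -> \bar R) :=
  convex01 (fun s => (y s - (mu / 2 * s ^+ 2)%:E)%E).

(* The modulus lam ||r0 - r1||^2 is a real number: r0 - r1 is in L^2(Q_T). *)
Definition directional_strongly_convex (lam : R) r0 m0 r1 m1 :=
  [/\ 0 < lam, (normQ T (r0 \- r1)%R < +oo)%E &
      strongly_convex01 (lam * fine (normQ T (r0 \- r1)%R) ^+ 2)
        (fun s => dynamic_cost (fun z => (1 - s) * r0 z + s * r1 z)
                               (fun z => (1 - s) *: m0 z + s *: m1 z))].

(* The best responses are indexed from 1. *)
Definition fictitious_play (delta : nat -> R)
    (rho rhoh : nat -> 'rV[R]_d * R -> R)
    (m mh : nat -> 'rV[R]_d * R -> 'rV[R]_d) :=
  forall k, (1 <= k)%N ->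
  [/\ best_response (rhoh k) (mh k) (rho k.-1),
      forall z, rho k z = (1 - delta k) * rho k.-1 z + delta k * rhoh k z &
      forall z, m k z = (1 - delta k) *: m k.-1 z + delta k *: mh k z].

End mean_field_game.

(* Main.v *)
(* Write (a, u) for an iterate and its best response, b = (1 - delta) a + delta u
   for the next iterate and w for the best response of b. Since the terminal cost
   does not depend on the evolution, J(h; r) = R(h) + F_r(h) with F_r linear in h,
   and r |-> F_r carries the coupling. Convexity of R gives
     g(b) <= (1 - delta) g(a) + (1 - delta) (F_b - F_a)(a - u)
             + J(u; b) - J(w; b).
   The second term is nonpositive by monotonicity, because b - a = delta (u - a).
   As u minimizes J(.; a), strong convexity of R between u and w gives
     J(u; b) - J(w; b) <= (F_b - F_a)(u - w) - lam/2 |u - w|^2,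
   which by Young's inequality and the Lipschitz bound
   |f(b) - f(a)| <= Lf delta |a - u| is at most Lf^2 delta^2 |a - u|^2 / (2 lam).
   Finally lam/2 |a - u|^2 <= g(a) by strong convexity between a and u, so that
   g(b) <= (1 - delta + (c/2) delta^2) g(a) <= exp(c delta^2 - delta) g(a).
   The pairing F_r(h) is finite because f(r) is bounded: by the backward equation
   it is a continuous function of the derivatives of a classical solution, once
   the Hamiltonian is known to be jointly continuous. *)
Require Import Defs.
From HB Require Import structures.
From mathcomp Require Import all_boot all_order all_algebra.
From mathcomp Require Import all_classical all_reals all_analysis.
From mathcomp Require Import measurable_realfun ring lra.

Set Implicit Arguments.
Unset Strict Implicit.
Unset Printing Implicit Defensive.

Import Order.TTheory GRing.Theory Num.Theory numFieldNormedType.Exports.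

Local Open Scope classical_set_scope.
Local Open Scope ring_scope.

(* [Defs.periodic] is shadowed by the notion of the same name in [trigo]. *)
Local Notation periodic := Defs.periodic.

(** * Borel sets and periodic functions *)

(** The product carries the product sigma-algebra. Balls with rational centre and radius form a
    countable base, so an open set is a countable union of measurable boxes. *)
Lemma open_measurable_rV_R (R : realType) (d : nat) (A : set ('rV[R]_d * R)) :
  open A -> measurable A.
Proof.
move=> oA.
pose c (q : 'rV[rat]_d) : 'rV[R]_d := \row_i ratr (q ord0 i).
pose B (p : 'rV[rat]_d * rat * rat) : set ('rV[R]_d * R) :=
  ball (c p.1.1) (ratr p.2 : R) `*` ball (ratr p.1.2 : R) (ratr p.2 : R).
have -> : A = \bigcup_(p in [set p | B p `<=` A]) B p.
  rewrite eqEsubset; split=> [[x t] Ax|x [p pA /pA//]].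
  have [e /= e0 eA] := (nbhs_ballP _ _).1 (open_nbhs_nbhs (conj oA Ax)).
  have /rat_in_itvoo[r] : (0 : R) < e / 2 by rewrite divr_gt0.
  rewrite in_itv/= => /andP[r0 re].
  have near_rat (s : R) : exists q : rat, ball (ratr q : R) (ratr r) s.
    have /rat_in_itvoo[q] : s - ratr r < s by rewrite ltrBlDr ltrDl.
    rewrite in_itv/= => /andP[q1 q2]; exists q.
    by rewrite /ball/= distrC gtr0_norm ?subr_gt0// ltrBlDr -ltrBlDl.
  have /choice[q qP] (i : 'I_d) := near_rat (x ord0 i).
  have [qt qtP] := near_rat t.
  have xB : ball (c (\row_i q i)) (ratr r : R) x.
    by split=> // i j; rewrite !mxE ord1.
  have double (U : pseudoMetricType R) (u v w : U) :
      ball u (ratr r : R) v -> ball u (ratr r : R) w -> ball v e w.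
    move=> uv uw; rewrite (splitr e); apply: (ball_triangle (y := u)).
      by apply: (le_ball (ltW re)); exact/ball_sym.
    exact: (le_ball (ltW re)).
  exists (\row_i q i, qt, r) => //= -[y s] [/= yB sB]; apply: eA.
  by split => /=; [exact: double xB yB|exact: double qtP sB].
rewrite bigcup_mkcond.
apply: countable_bigcupT_measurable => [|p]; first exact: countableP.
case: ifPn => _; last exact: measurable0.
apply: measurableX; last by rewrite ball_itv; exact: measurable_itv.
by apply: sub_sigma_algebra; exact: ball_open.
Qed.

Lemma continuous_measurable_rV_R (R : realType) (d : nat)
    (G : 'rV[R]_d * R -> R) : continuous G -> measurable_fun setT G.
Proof.
move=> /continuousP cG; apply: (measurability _ (RGenOpens.measurableE R)).
move=> _ [_ [a [b ->] <-]]; have oA := @interval_open R (BRight a) (BLeft b) erefl erefl.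
rewrite setTI; apply: open_measurable_rV_R; exact: cG oA.
Qed.

Lemma continuous_measurable_rV (R : realType) (d : nat)
    (G : 'rV[R]_d -> R) : continuous G -> measurable_fun setT G.
Proof.
move=> /continuousP cG; apply: (measurability _ (RGenOpens.measurableE R)).
move=> _ [_ [a [b ->] <-]]; have oA := @interval_open R (BRight a) (BLeft b) erefl erefl.
rewrite setTI; apply: sub_sigma_algebra; exact: cG oA.
Qed.

Section periodic_bounded.
Variables (R : realType) (d : nat).

Definition closed_cube : set 'rV[R]_d := [set x | forall i, `[0, 1]%classic (x ord0 i)].

Lemma compact_closed_cube : compact closed_cube.
Proof.
by apply: (@rV_compact R d (fun=> `[0, 1]%classic)) => i; exact: segment_compact.
Qed.

Lemma periodic_int_shift (T : Type) (G : 'rV[R]_d -> T) (i : 'I_d) (n : int)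
    (x : 'rV[R]_d) :
  periodic G -> G (x + n%:~R *: delta_mx ord0 i) = G x.
Proof.
move=> pG.
have pos (k : nat) y : G (y + k%:R *: delta_mx ord0 i) = G y.
  elim: k y => [|k IH] y; first by rewrite scale0r addr0.
  by rewrite -natr1 scalerDl scale1r addrA pG IH.
case: n => k; first by rewrite -pmulrn.
rewrite -[in RHS](subrK (k.+1%:R *: delta_mx ord0 i) x) pos NegzE.
by rewrite mulrNz scaleNr.
Qed.

Lemma periodic_reduce (x : 'rV[R]_d) : exists2 y, closed_cube y &
  forall (T : Type) (G : 'rV[R]_d -> T), periodic G -> G x = G y.
Proof.
exists (x - \sum_i (Num.floor (x ord0 i))%:~R *: delta_mx ord0 i).
  move=> i /=; rewrite !mxE summxE (bigD1 i)//= big1 => [|j ji].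
    rewrite !mxE !eqxx mulr1 addr0 in_itv/=.
    have := floor_le (x ord0 i); have := floorD1_gt (x ord0 i).
    by rewrite intrD => lt1 le0; apply/andP; split; lra.
  by rewrite !mxE eqxx eq_sym (negbTE ji) mulr0.
move=> T G pG.
elim/big_rec : _ => [|i s _ ->]; first by rewrite subr0.
rewrite opprD addrCA addrC -scaleNr -mulrNz periodic_int_shift//.
Qed.

Lemma periodic_continuous_bounded (G : 'rV[R]_d -> R) :
  periodic G -> continuous G -> exists M, forall x, `|G x| <= M.
Proof.
move=> pG cG.
have /compact_bounded[M [_ MP]] : compact (G @` closed_cube).
  apply: continuous_compact compact_closed_cube.
  exact: continuous_subspaceT.
exists (M + 1) => x; have [y yC ->//] := periodic_reduce x.
by apply: (MP (M + 1)); [rewrite ltrDl|exists y].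
Qed.

(** [G] is controlled only inside the open cylinder. Periodicity moves the point into the compact
    product of [closed_cube] and [[0, T]], on which the continuous [E] is bounded. *)
Lemma periodic_continuous_bounded_cyl (T : R) (G E : 'rV[R]_d * R -> R) :
  (forall t, 0 < t < T -> periodic (slice G t)) -> continuous E ->
  (forall x t, 0 < t < T -> G (x, t) = E (x, t)) ->
  exists M, forall z, cyl d T z -> `|G z| <= M.
Proof.
move=> pG cE GE.
have /compact_bounded[M [_ MP]] : compact (E @` (closed_cube `*` `[0, T]%classic)).
  apply: continuous_compact; first exact: continuous_subspaceT.
  by apply: compact_setX; [exact: compact_closed_cube|exact: segment_compact].
exists (M + 1) => -[x t] [_ /=]; rewrite in_itv/= => t0T.
have [y yC /(_ _ _ (pG t t0T))] := periodic_reduce x.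
rewrite /slice => ->; rewrite GE//.
apply: (MP (M + 1)); [by rewrite ltrDl|exists (y, t) => //; split=> //=].
by rewrite in_itv/=; case/andP: t0T => /ltW -> /ltW ->.
Qed.

End periodic_bounded.

(** * Joint continuity of the Hamiltonian *)

Lemma cvg_sumr (R : realType) (T I : Type) (F : set_system T) (FF : Filter F)
    (r : seq I) (f : I -> T -> R) (l : I -> R) :
  (forall i, f i x @[x --> F] --> l i) ->
  \sum_(i <- r) f i x @[x --> F] --> \sum_(i <- r) l i.
Proof.
move=> fl; elim: r => [|i r IH].
  by under eq_fun do rewrite big_nil; rewrite big_nil; exact: cvg_cst.
by under eq_fun do rewrite big_cons; rewrite big_cons; exact: cvgD.
Qed.

Section convex_joint_continuity.
Variables (R : realType) (d : nat).
Implicit Types (g : 'rV[R]_d -> R).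

Definition weakly_convex g := forall p q s, 0 <= s <= 1 ->
  g ((1 - s) *: p + s *: q) <= (1 - s) * g p + s * g q.

Lemma weakly_convex_translate g p : weakly_convex g ->
  weakly_convex (fun u => g (p + u) - g p).
Proof.
move=> gc u v s s01.
have := gc (p + u) (p + v) s s01.
rewrite !scalerDr addrACA -scalerDl subrK scale1r => le1.
have -> : (1 - s) * (g (p + u) - g p) + s * (g (p + v) - g p)
  = (1 - s) * g (p + u) + s * g (p + v) - g p by ring.
by rewrite lerD2r.
Qed.

(* Halving splits off one coordinate at a time, hence the factor [2 ^ size s]. *)
Lemma weakly_convex_le_sum g C (s : seq 'I_d) (a : 'I_d -> R) :
  weakly_convex g -> g 0 = 0 ->
  (forall i, g (delta_mx ord0 i) <= C /\ g (- delta_mx ord0 i) <= C) ->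
  (forall i, 2 ^+ size s * `|a i| <= 1) ->
  g (\sum_(i <- s) a i *: delta_mx ord0 i) <= C * \sum_(i <- s) `|a i|.
Proof.
move=> gc g0 gC.
(* For [|t| <= 1], the point [t e_i] lies between [0] and [e_i] or [- e_i]. *)
have line i t : `|t| <= 1 -> g (t *: delta_mx ord0 i) <= C * `|t|.
  move=> t1; have t01 : 0 <= `|t| <= 1 by rewrite normr_ge0.
  have [gCp gCn] := gC i.
  have [t0|t0] := leP 0 t.
    have := gc 0 (delta_mx ord0 i) _ t01.
    rewrite scaler0 add0r g0 mulr0 add0r ger0_norm// => /le_trans; apply.
    by rewrite mulrC ler_wpM2r.
  have := gc 0 (- delta_mx ord0 i) _ t01.
  rewrite scaler0 add0r g0 mulr0 add0r ltr0_norm// scalerN scaleNr opprK.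
  move=> /le_trans; apply.
  by rewrite mulrC ler_wpM2r// oppr_ge0 ltW.
elim: s a => [|i s IH] a aP; first by rewrite !big_nil g0 mulr0.
rewrite !big_cons.
have half : 0 <= (2^-1 : R) <= 1 by lra.
have := gc (2 *: (a i *: delta_mx ord0 i))
  (\sum_(j <- s) (2 * a j) *: delta_mx ord0 j) _ half.
have h2 : 2^-1 * 2 = 1 :> R by rewrite mulVf// pnatr_eq0.
rewrite (_ : 1 - 2^-1 = 2^-1 :> R); last by field.
rewrite (scalerA 2^-1 2) h2 scale1r.
have -> : 2^-1 *: (\sum_(j <- s) (2 * a j) *: delta_mx ord0 j) =
    \sum_(j <- s) a j *: delta_mx ord0 j :> 'rV[R]_d.
  by rewrite scaler_sumr; apply: eq_bigr => j _; rewrite scalerA mulrA h2 mul1r.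
move=> /le_trans; apply.
have pow2 : 1 <= 2 ^+ size s :> R by rewrite exprn_ege1// ler1n.
have le1 : g (2 *: (a i *: delta_mx ord0 i)) <= C * (2 * `|a i|).
  rewrite scalerA -[X in C * (X * _)]ger0_norm// -normrM; apply: line.
  rewrite normrM ger0_norm//; apply: le_trans (aP i).
  by rewrite /= exprS -mulrA ler_wpM2l// ler_peMl.
have le2 : g (\sum_(j <- s) (2 * a j) *: delta_mx ord0 j)
    <= C * (2 * \sum_(j <- s) `|a j|).
  have normE j : `|2 * a j| = 2 * `|a j| by rewrite normrM ger0_norm.
  have -> : 2 * (\sum_(j <- s) `|a j|) = \sum_(j <- s) `|2 * a j|.
    by rewrite mulr_sumr; apply: eq_bigr => j _; rewrite normE.
  by apply: IH => j; rewrite normE mulrA -exprSr.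
by rewrite mulrDr; lra.
Qed.

(** [0] is the midpoint of [- u] and [u], so upper bounds near [0] also give lower bounds. *)
Lemma weakly_convex_ge_opp g u : weakly_convex g -> g 0 = 0 -> - g (- u) <= g u.
Proof.
move=> gc g0; have half : 0 <= (2^-1 : R) <= 1 by lra.
have := gc (- u) u _ half.
rewrite (_ : 1 - 2^-1 = 2^-1 :> R); last by field.
by rewrite -scalerDr addNr scaler0 g0; lra.
Qed.

(* On the cross-polytope of small radius around [p z0], convexity bounds the
   increments of [h z] in terms of its values at the vertices, which are
   continuous in [z]. *)
Lemma convex_family_continuous (Z : topologicalType)
    (h : Z -> 'rV[R]_d -> R) (p : Z -> 'rV[R]_d) :
  (forall z, weakly_convex (h z)) -> (forall q, continuous (h^~ q)) ->
  (forall i, continuous (fun z => p z ord0 i)) ->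
  continuous (fun z => h z (p z)).
Proof.
move=> hc hq cp z0.
pose g z u := h z (p z0 + u) - h z (p z0).
have gc z : weakly_convex (g z) := weakly_convex_translate _ (hc z).
have g0 z : g z 0 = 0 by rewrite /g addr0 subrr.
have cg u : continuous (g^~ u) by move=> z; apply: cvgB; exact: hq.
pose a z i := p z ord0 i - p z0 ord0 i.
have sumE z : p z - p z0 = \sum_i a z i *: delta_mx ord0 i.
  rewrite [LHS]row_sum_delta; apply: eq_bigr => i _.
  by rewrite !mxE.
have sumNE z : - (p z - p z0) = \sum_i (- a z i) *: delta_mx ord0 i.
  by rewrite sumE -sumrN; apply: eq_bigr => i _; rewrite scaleNr.
have ca i : a z i @[z --> z0] --> (0 : R).
  by rewrite -(subrr (p z0 ord0 i)); apply: cvgB; [exact: cp|exact: cvg_cst].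
(* The added [1] makes [C] exceed strictly every vertex value at [z0], so by continuity it still
   bounds them for [z] near [z0]. *)
pose C : R := 1 + \sum_i (`|g z0 (delta_mx ord0 i)| + `|g z0 (- delta_mx ord0 i)|).
have gC i : g z0 (delta_mx ord0 i) < C /\ g z0 (- delta_mx ord0 i) < C.
  have leC : `|g z0 (delta_mx ord0 i)| + `|g z0 (- delta_mx ord0 i)| <= C - 1.
    rewrite /C addrAC subrr add0r (bigD1 i)//= lerDl.
    by apply: sumr_ge0 => j _; rewrite addr_ge0.
  have := ler_norm (g z0 (delta_mx ord0 i)).
  have := ler_norm (g z0 (- delta_mx ord0 i)).
  have := normr_ge0 (g z0 (delta_mx ord0 i)).
  have := normr_ge0 (g z0 (- delta_mx ord0 i)).
  by move=> *; split; lra.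
have nearC : \forall z \near z0, forall i,
    g z (delta_mx ord0 i) <= C /\ g z (- delta_mx ord0 i) <= C.
  apply: filter_forall => i; have [g1 g2] := gC i.
  near=> z; split; apply/ltW; near: z.
    exact: (cvgr_lt _ (cg (delta_mx ord0 i) z0)).
  exact: (cvgr_lt _ (cg (- delta_mx ord0 i) z0)).
have neara : \forall z \near z0, forall i,
    2 ^+ size (index_enum 'I_d) * `|a z i| <= 1.
  apply: filter_forall => i.
  have pow0 : 0 < 2 ^+ size (index_enum 'I_d) :> R by rewrite exprn_gt0.
  near=> z; rewrite mulrC -ler_pdivlMr// mul1r ltW//; near: z.
  have : `|a z i| @[z --> z0] --> (0 : R).
    by rewrite -(normr0 R); apply: cvg_norm; exact: ca.
  by move=> /cvgr_lt; apply; rewrite invr_gt0.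
have bound : \forall z \near z0,
    `|h z (p z) - h z (p z0)| <= C * \sum_i `|a z i|.
  near=> z.
  have gE : g z (p z - p z0) = h z (p z) - h z (p z0) by rewrite /g (addrC (p z0)) subrK.
  have zC : forall i, g z (delta_mx ord0 i) <= C /\ g z (- delta_mx ord0 i) <= C.
    by near: z.
  have za : forall i, 2 ^+ size (index_enum 'I_d) * `|a z i| <= 1 by near: z.
  rewrite -gE ler_norml; apply/andP; split.
    apply: le_trans (weakly_convex_ge_opp _ (gc z) (g0 z)); rewrite lerN2 sumNE.
    apply: (le_trans (weakly_convex_le_sum (gc z) (g0 z) zC _)) => [i|].
      by rewrite normrN.
    by rewrite (eq_bigr (fun i => `|a z i|))// => i _; rewrite normrN.
  by rewrite sumE; exact: (weakly_convex_le_sum (gc z) (g0 z) zC za).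
have sum0 : C * (\sum_i `|a z i|) @[z --> z0] --> (0 : R).
  rewrite -[X in _ --> X](mulr0 C); apply: cvgM; first exact: cvg_cst.
  have sum0 : \sum_(i < d) `|0 : R| = 0 by rewrite big1// => i _; rewrite normr0.
  rewrite -[X in _ --> X]sum0; apply: cvg_sumr => i; apply: cvg_norm.
  exact: ca.
have diff0 : h z (p z) - h z (p z0) @[z --> z0] --> (0 : R).
  apply/norm_cvg0P.
  apply: (squeeze_cvgr _ (cvg_cst 0) sum0).
  by near=> z; rewrite normr_ge0/=; near: z.
have dsum : (h z (p z) - h z (p z0)) + h z (p z0) @[z --> z0] --> h z0 (p z0).
  by rewrite -[X in _ --> X]add0r; apply: cvgD => //; exact: hq.
apply: cvg_trans dsum; apply: near_eq_cvg.
by near=> z; rewrite /= subrK.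
Unshelve. all: by end_near. Qed.

End convex_joint_continuity.

(** * Integration on space-time *)

(* The time factor of [lebQ] carries the measurable structure on which
   [lebesgue_measure] is defined. It is convertible to the canonical structure of
   [R], but unification does not see it: hence this instance and the explicit
   arguments [lebQ R d] below. *)
#[export] Instance lebQ_ae_filter (R : realType) (d : nat) :
  Filter (nbhs (almost_everywhere (lebQ R d))).
Proof. exact: (@ae_filter_ringOfSetsType _ _ R (lebQ R d)). Qed.

Section space_time_integration.
Variables (R : realType) (d : nat).
Implicit Types (T t : R) (f : 'rV[R]_d * R -> \bar R).

Lemma measurable_cyl T : measurable (cyl d T : set ('rV[R]_d * R)).
Proof. by apply: measurableX => //; exact: measurable_itv. Qed.

Lemma measurable_cylbar T : measurable (cylbar d T : set ('rV[R]_d * R)).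
Proof. by apply: measurableX => //; exact: measurable_itv. Qed.

Lemma cyl_cylbar T : cyl d T `<=` (cylbar d T : set ('rV[R]_d * R)).
Proof.
move=> [x t] [_ /=]; rewrite in_itv/= => /andP[t0 tT]; split=> //=.
by rewrite in_itv/= !ltW.
Qed.

Lemma cylE T (x : 'rV[R]_d) t : cyl d T (x, t) <-> 0 < t < T.
Proof. by rewrite /cyl /setX/= in_itv/=; split=> [[]|]. Qed.

Lemma restrict_cyl T f (x : 'rV[R]_d) t : (0 < t < T) ->
  (f \_ (cyl d T)) (x, t) = f (x, t).
Proof. by move=> t0T; rewrite patchE mem_set//; exact/cylE. Qed.

Lemma measurable_slice T f t : measurable_fun (cyl d T) f -> 0 < t < T ->
  measurable_fun setT (fun x => f (x, t)).
Proof.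
move=> /(measurable_restrictT _ (measurable_cyl T)) mf t0T.
rewrite (_ : (fun x => _) = (f \_ (cyl d T)) \o (pair^~ t)).
  by apply: measurableT_comp => //; exact: pair2_measurable.
by apply/funext => x /=; rewrite restrict_cyl.
Qed.

Lemma slice_restrict_cyl T f t : (\int[leb R d]_x (f \_ (cyl d T)) (x, t) =
  ((fun s => \int[leb R d]_x f (x, s)) \_ `]0%R, T[) t)%E.
Proof.
rewrite [RHS]patchE; case: ifPn => [|/negP tT].
  rewrite inE/= in_itv/= => t0T; apply: eq_integral => x _.
  by rewrite restrict_cyl.
rewrite (eq_integral (cst 0%E)) ?integral0// => x _.
rewrite patchE memNset// => /cylE t0T; apply: tT.
by rewrite inE/= in_itv.
Qed.

Lemma tonelli_cyl T f : measurable_fun (cyl d T) f ->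
  (forall z, cyl d T z -> 0 <= f z)%E ->
  (\int[lebQ R d]_(z in cyl d T) f z =
   \int[lebesgue_measure]_(t in `]0%R, T[) \int[leb R d]_x f (x, t))%E.
Proof.
move=> mf f0; rewrite integral_mkcond [RHS]integral_mkcond.
rewrite /lebQ fubini_tonelli2.
- by apply: eq_integral => t _; exact: slice_restrict_cyl.
- exact/(measurable_restrictT _ (measurable_cyl T)).
- by move=> z; apply: erestrict_ge0.
Qed.

Lemma fubini_cyl T f : (lebQ R d).-integrable (cyl d T) f ->
  (\int[lebQ R d]_(z in cyl d T) f z =
   \int[lebesgue_measure]_(t in `]0%R, T[) \int[leb R d]_x f (x, t))%E.
Proof.
move=> intf.
have {}intf := (@integrable_mkcond _ _ R (lebQ R d) _ f (measurable_cyl T)).1 intf.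
rewrite integral_mkcond [RHS]integral_mkcond /lebQ -integral21_prod_meas1//.
by apply: eq_integral => t _; exact: slice_restrict_cyl.
Qed.

Lemma measurable_slice_integral T f : measurable_fun (cyl d T) f ->
  (forall z, cyl d T z -> 0 <= f z)%E ->
  measurable_fun `]0%R, T[ (fun t => \int[leb R d]_x f (x, t))%E.
Proof.
move=> mf f0; apply/measurable_restrictT => //.
rewrite (_ : _ \_ _ = fubini_G (leb R d) (f \_ (cyl d T))).
  apply: measurable_fun_fubini_tonelli_G.
    exact/(measurable_restrictT _ (measurable_cyl T)).
  by move=> z; apply: erestrict_ge0.
by apply/funext => t; rewrite -slice_restrict_cyl.
Qed.

(** By Tonelli the integral of [|f|] is an iterated integral whose inner integrals all vanish, and a
    vanishing integral forces [f = 0] almost everywhere. *)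
Lemma ae_cyl T f : measurable_fun (cyl d T) f ->
  (forall t, 0 < t < T -> {ae leb R d, forall x, f (x, t) = 0%E}) ->
  ae_eq (lebQ R d) (cyl d T) f (cst 0%E).
Proof.
move=> mf f0; apply/ae_eq_integral_abs => //; first exact: measurable_cyl.
rewrite tonelli_cyl//; last exact: measurableT_comp.
rewrite (eq_integral (cst 0%E)) ?integral0// => t.
rewrite inE/= in_itv/= => t0T.
have /(ae_eq_integral_abs (leb R d) measurableT)[_ ->//] := measurable_slice mf t0T.
by have := f0 t t0T; apply: filterS => x fx _.
Qed.

End space_time_integration.

(** [h] agrees almost everywhere with the Radon-Nikodym derivative of [mu], since both have the same
    integral over every measurable set. *)
Lemma integral_has_density (R : realType) (d : nat) (mu : torus_prob R d)
    (h : 'rV[R]_d -> R) (G : 'rV[R]_d -> \bar R) :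
  measurable_fun setT h -> (forall x, 0 <= h x) -> has_density mu h ->
  mu.-integrable setT G ->
  (\int[mu]_x G x = \int[leb R d]_x (G x * (h x)%:E))%E.
Proof.
move=> mh h0 muh intG.
have dom : mu `<< leb R d.
  apply/null_content_dominatesP => A mA A0; rewrite muh//.
  apply: null_set_integral => //; apply: measurable_funTS.
  exact/measurable_EFinP.
rewrite -(Radon_Nikodym_change_of_variables dom)//.
have mG := measurable_int _ intG.
have meh : measurable_fun setT (EFin \o h) by exact/measurable_EFinP.
pose nu := charge_of_finite_measure mu.
have intD := @Radon_Nikodym_integrable _ _ _ nu (leb R d) dom.
have mD := measurable_int _ intD.
apply: ae_eq_integral => //; [exact: emeasurable_funM|exact: emeasurable_funM|].
apply: ae_eqe_mul2l; apply: integral_ae_eq => // E _ mE.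
by rewrite -(@Radon_Nikodym_integral _ _ _ nu)//= -muh.
Qed.

(** * Linear combinations and bounded multiples of integrable functions *)

Section linear_combinations.
Context (dd : measure_display) (X : measurableType dd) (R : realType).
Variables (mu : {measure set X -> \bar R}) (D : set X) (mD : measurable D).
Variables (f g : X -> R) (a b : R).
Hypotheses (intf : mu.-integrable D (EFin \o f))
  (intg : mu.-integrable D (EFin \o g)).

Lemma integrable_lincomb :
  mu.-integrable D (fun x => (a * f x + b * g x)%:E).
Proof.
have := integrableD mD (integrableZl mD a intf) (integrableZl mD b intg).
by apply: eq_integrable.
Qed.

Lemma integral_lincomb : (\int[mu]_(x in D) (a * f x + b * g x)%:E =
  a%:E * \int[mu]_(x in D) (f x)%:E + b%:E * \int[mu]_(x in D) (g x)%:E)%E.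
Proof.
under eq_integral do rewrite EFinD !EFinM.
rewrite integralD//; [|exact: integrableZl|exact: integrableZl].
by rewrite !integralZl.
Qed.

End linear_combinations.

Lemma integrable_ae_bounded_mul (dd : measure_display) (X : measurableType dd)
    (R : realType) (mu : {measure set X -> \bar R}) (D : set X) (a f : X -> R)
    (M : R) :
  measurable D -> measurable_fun D a ->
  {ae mu, forall x, D x -> `|a x| <= M} -> mu.-integrable D (EFin \o f) ->
  mu.-integrable D (fun x => (a x * f x)%:E).
Proof.
move=> mD ma aM intf; have mf := measurable_int _ intf.
have {}mf : measurable_fun D f by exact/measurable_EFinP.
have intMf := integrableZl mD `|M| intf.
apply/integrableP; split; first by apply/measurable_EFinP; exact: measurable_funM.
have [_] := integrableP _ _ _ intMf; apply: le_lt_trans.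
apply: ae_ge0_le_integral => //.
- by do 2 apply: measurableT_comp => //; exact: measurable_funM.
- by apply: measurableT_comp => //; exact: measurable_int intMf.
- apply: filterS aM => x aM Dx; rewrite lee_fin !normrM.
  by rewrite normr_id ler_wpM2r// (le_trans (aM Dx))// ler_norm.
Qed.

Lemma integrable_bounded_mul (dd : measure_display) (X : measurableType dd)
    (R : realType) (mu : {measure set X -> \bar R}) (D : set X) (a f : X -> R)
    (M : R) :
  measurable D -> measurable_fun D a ->
  (forall x, D x -> `|a x| <= M) -> mu.-integrable D (EFin \o f) ->
  mu.-integrable D (fun x => (a x * f x)%:E).
Proof.
move=> mD ma aM; apply: (@integrable_ae_bounded_mul _ _ _ _ _ _ _ M) => //.
by apply: aeW => x Dx; exact: aM.
Qed.

(** * Density evolutions and their representatives *)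

Section evolutions.
Variables (R : realType) (d : nat).
Implicit Types (T t : R) (r : 'rV[R]_d * R -> R).

Lemma ltW_itv T t : 0 < t < T -> 0 <= t <= T.
Proof. by case/andP => /ltW -> /ltW ->. Qed.

Lemma is_density_integrable (h : 'rV[R]_d -> R) : is_density h ->
  (leb R d).-integrable setT (EFin \o h).
Proof.
move=> [_ mh h0 h1]; apply/integrableP; split; first exact/measurable_EFinP.
under eq_integral do rewrite /= ger0_norm//.
by rewrite h1 ltry.
Qed.

Lemma density_evolution_measurable T r : density_evolution T r ->
  measurable_fun (cyl d T) r.
Proof.
move=> [mr _ _]; apply: measurable_funS mr; first exact: measurable_cylbar.
exact: cyl_cylbar.
Qed.

Lemma density_evolution_ge0 T r z : density_evolution T r -> cyl d T z ->
  0 <= r z.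
Proof.
case: z => x t [_ rd _] /cylE /ltW_itv t0T.
by have [_ _ /(_ x)] := rd t t0T.
Qed.

(** Every slice has mass one, so by Tonelli the total mass is the length of the time interval. *)
Lemma density_evolution_integrable T r : density_evolution T r ->
  (lebQ R d).-integrable (cyl d T) (EFin \o r).
Proof.
move=> rP; have mr := density_evolution_measurable rP.
apply/integrableP; split; first exact/measurable_EFinP.
rewrite tonelli_cyl//; last by do 2 apply: measurableT_comp => //.
rewrite (eq_integral (cst 1%E)) => [|t].
  by rewrite integral_cst//= mul1e lebesgue_measure_itv/=; case: ifP; rewrite ltry.
rewrite inE/= in_itv/= => t0T; case: rP => _ /(_ t) rd _.
have [_ _ r0 <-] := rd (ltW_itv t0T).
by apply: eq_integral => x _; rewrite /= ger0_norm//; exact: r0.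
Qed.

Lemma eq_evolution_ae T r r1 : density_evolution T r -> density_evolution T r1 ->
  eq_evolution T r r1 -> {ae lebQ R d, forall z, cyl d T z -> r z = r1 z}.
Proof.
move=> rP r1P rr1.
have mr := density_evolution_measurable rP.
have mr1 := density_evolution_measurable r1P.
have /= := @ae_cyl R d T (fun z => (r z - r1 z)%:E) _ _.
have H : measurable_fun (cyl d T) (fun z => (r z - r1 z)%:E).
  by apply/measurable_EFinP; exact: measurable_funB.
move=> /(_ H)[|N [mN N0 sub]].
  by move=> t /ltW_itv /rr1; apply: filterS => x ->; rewrite subrr.
exists N; split => // z /= zP; apply: sub => /= z0; apply: zP => zQ.
by have [/eqP] := z0 zQ; rewrite subr_eq0 => /eqP.
Qed.

Lemma has_density_ae (h h1 : 'rV[R]_d -> R) (mu : torus_prob R d) :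
  measurable_fun setT h -> measurable_fun setT h1 ->
  {ae leb R d, forall x, h x = h1 x} -> has_density mu h -> has_density mu h1.
Proof.
move=> mh mh1 hh1 muh A mA; rewrite muh//; apply: ae_eq_integral => //.
- by apply: measurable_funTS; exact/measurable_EFinP.
- by apply: measurable_funTS; exact/measurable_EFinP.
- by apply: filterS hh1 => x -> _.
Qed.

(** Both densities define the same predicate on measures, so the choice operator selects the same
    measure for both. *)
Lemma prob_of_density_ae (h h1 : 'rV[R]_d -> R) :
  measurable_fun setT h -> measurable_fun setT h1 ->
  {ae leb R d, forall x, h x = h1 x} -> prob_of_density h = prob_of_density h1.
Proof.
move=> mh mh1 hh1; rewrite /prob_of_density.
rewrite (_ : (fun mu => has_density mu h) = (fun mu => has_density mu h1))//.
apply/funext => mu; apply/propext; split; apply: has_density_ae => //.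
by apply: filterS hh1 => x ->.
Qed.

End evolutions.

(** * Regularity of the costs *)

Section cost_regularity.
Variables (R : realType) (d : nat) (D : mfg R d).
Hypothesis hD : standing_assumptions D.
Let T := horizon D.
Implicit Types (r phi : 'rV[R]_d * R -> R).

Lemma near_strip (x : 'rV[R]_d) t : 0 < t < T ->
  \forall z \near (x, t), 0 < z.2 < T.
Proof.
move=> t0T; exists ([set: 'rV[R]_d], `]0, T[%classic) => /=.
  split; first exact: filterT.
  by apply: near_in_itvoo; rewrite in_itv.
by move=> [y s] [_ /=]; rewrite in_itv.
Qed.

Lemma derive_eq_strip (F G : 'rV[R]_d * R -> R) v z :
  (forall z, 0 < z.2 < T -> F z = G z) -> 0 < z.2 < T ->
  'D_v F z = 'D_v G z.
Proof.
case: z => x t FG /= t0T; apply: near_eq_derive.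
by have := near_strip x t0T; apply: filterS => z; exact: FG.
Qed.

Lemma ham_weakly_convex x : weakly_convex (ham D x).
Proof.
have [_ _ [_ _ _ /(_ x) Hc _] _ _] := hD.
move=> p q s /andP[]; rewrite le_eqVlt => /predU1P[<- _|s0].
  by rewrite subr0 !scale1r !mul1r !scale0r !mul0r !addr0.
rewrite le_eqVlt => /predU1P[->|s1].
  by rewrite subrr !scale1r !mul1r !scale0r !mul0r !add0r.
have [->|pq] := eqVneq p q; last by apply/ltW/Hc => //; rewrite s0.
by rewrite -scalerDl subrK scale1r -mulrDl subrK mul1r.
Qed.

Lemma ham_continuous p : continuous ((ham D)^~ p).
Proof. by have [_ _ [_ /(_ p) /= [] ]] := hD. Qed.

(** The backward equation expresses the running cost through [phi]. Inside the strip the derivatives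
    of [phi] are those of its extension [E], which are continuous, and convexity in [p] makes the
    Hamiltonian term jointly continuous. *)
Lemma backward_eq_continuous r phi : backward_eq D r phi ->
  exists2 B : 'rV[R]_d * R -> R, continuous B &
    forall x t, 0 < t < T -> cost_along D r (x, t) = B (x, t).
Proof.
move=> [[_ [E Ephi [cE [_ cdt] cdir cdir2]]] eqn _].
pose v := visc D.
exists (fun z => - dt E z - v * lap E z + ham D z.1 (grad E z)).
  move=> z; apply: cvgD; last first.
    apply: (@convex_family_continuous R d _ (fun z => ham D z.1) (grad E)).
    - by move=> y; exact: ham_weakly_convex.
    - move=> q y; apply: (@continuous_comp _ _ _ fst ((ham D)^~ q)).
        exact: cvg_fst.
      exact: ham_continuous.
    - move=> i; under eq_fun do rewrite mxE.
      by have [_] := cdir i.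
  apply: cvgB; first by apply: cvgN; exact: cdt.
  apply: cvgM; first exact: cvg_cst.
  by apply: cvg_sumr => i; have [_] := cdir2 i i; exact.
have EphiS z : 0 < z.2 < T -> phi z = E z.
  by case: z => x t /= t0T; rewrite Ephi//; exact: ltW_itv.
have deriv w z : 0 < z.2 < T -> 'D_w phi z = 'D_w E z.
  by move=> z0T; exact: derive_eq_strip.
move=> x t t0T; rewrite -(eqn x t t0T).
have -> : dt phi (x, t) = dt E (x, t) by exact: deriv.
have -> : lap phi (x, t) = lap E (x, t).
  by apply: eq_bigr => i _; apply: derive_eq_strip => // z; exact: deriv.
have -> : grad phi (x, t) = grad E (x, t) by apply/rowP => i; rewrite !mxE deriv.
by [].
Qed.

Lemma cost_along_periodic r t : density_evolution T r -> 0 <= t <= T ->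
  periodic (slice (cost_along D r) t).
Proof.
move=> [_ /(_ t) rd _] t0T i x; have [rp _ r0 _] := rd t0T.
have [_ _ _ + _] := hD.
rewrite /slice /cost_along /coupling_at /=; case: (cost D) => [F|F] /=.
  by case/(_ (prob_of_density (slice r t))) => Fp _; exact: Fp.
by case=> Fp _; rewrite rp; apply: Fp; exact: r0.
Qed.

(** The bound holds along the representative [r1] that satisfies the backward equation and is
    transferred to [r]. A nonlocal cost sees only the measure, so it is the same along [r] and [r1]
    at every point of the cylinder; a local cost agrees almost everywhere. *)
Lemma regular_cost_bounded r : density_evolution T r -> regular_evolution D r ->
  measurable_fun (cyl d T) (cost_along D r) /\
  exists M, {ae lebQ R d, forall z, cyl d T z -> `|cost_along D r z| <= M}.
Proof.
move=> rP [r1 [r1P rr1] [phi [_ [[/backward_eq_continuous[B cB r1B] _] _ _ _]]]].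
have [M MP] : exists M, forall z, cyl d T z -> `|cost_along D r1 z| <= M.
  apply: (periodic_continuous_bounded_cyl (E := B)) => // t /ltW_itv.
  exact: cost_along_periodic.
have [_ _ _ + _] := hD.
have costE (F : 'rV[R]_d -> R -> R) : cost D = Local F ->
    cost_along D r = (fun z => F z.1 (r z)).
  by rewrite /cost_along /coupling_at => ->; apply/funext => -[].
have costE1 (F : 'rV[R]_d -> R -> R) : cost D = Local F ->
    cost_along D r1 = (fun z => F z.1 (r1 z)).
  by rewrite /cost_along /coupling_at => ->; apply/funext => -[].
case E : (cost D) => [F|F] /=; move=> FP.
  have eqF z : cyl d T z -> cost_along D r z = cost_along D r1 z.
    case: z => x t /cylE /ltW_itv t0T.
    rewrite /cost_along /coupling_at E /= (@prob_of_density_ae _ _ _ (slice r1 t))//.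
    - by case: rP => _ /(_ t t0T)[].
    - by case: r1P => _ /(_ t t0T)[].
    - exact: rr1.
  split; last by exists M; apply: aeW => z zP; rewrite eqF//; exact: MP.
  apply: (eq_measurable_fun B); last first.
    apply: measurable_funTS; exact: continuous_measurable_rV_R.
  by move=> [x t]; rewrite inE => zP; have /cylE t0T := zP; rewrite eqF// r1B.
case: FP => _ [G cG GF]; split.
  rewrite (costE _ E).
  (* Restriction by zero makes the density measurable on the whole space; on the cylinder its values
     are nonnegative, where [G] coincides with [F]. *)
  apply: (eq_measurable_fun (fun z => G (z.1, (r \_ (cyl d T)) z))).
    move=> z zP; rewrite patchE zP GF//.
    by apply: density_evolution_ge0 rP _; exact: set_mem.
  have mG : measurable_fun setT G.
    by apply: continuous_measurable_rV_R; case: cG.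
  apply: measurable_funTS; apply: (measurableT_comp mG).
  apply: measurable_fun_pair; first exact: measurable_fst.
  apply/(measurable_restrictT _ (measurable_cyl T)).
  exact: density_evolution_measurable.
exists M; apply: filterS (eq_evolution_ae rP r1P rr1) => z rz zP.
by have := MP z zP; rewrite (costE _ E) (costE1 _ E) rz.
Qed.

Lemma integrable_cost_mul r h : density_evolution T r ->
  regular_evolution D r -> (lebQ R d).-integrable (cyl d T) (EFin \o h) ->
  (lebQ R d).-integrable (cyl d T) (fun z => (cost_along D r z * h z)%:E).
Proof.
move=> rP rreg inth; have [mc [M cM]] := regular_cost_bounded rP rreg.
apply: (@integrable_ae_bounded_mul _ _ R (lebQ R d) _ _ h M) => //.
exact: measurable_cyl.
Qed.

(** The cost is frozen at a reference argument: Lebesgue measure if nonlocal, the density value [0]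
    if local. *)
Lemma terminal_cost : coupling_independent (costT D) ->
  exists psi : 'rV[R]_d -> R, [/\ measurable_fun setT psi,
    exists M, forall x, `|psi x| <= M &
    forall h, is_density h -> coupling_at (costT D) h = psi].
Proof.
have [_ _ _ _] := hD; rewrite /coupling_at; case: (costT D) => [F|F] /=.
  move=> FP Findep; exists (F^~ (leb_prob R d)).
  have [Fp [cF _ _]] := FP (leb_prob R d); split.
  - exact: continuous_measurable_rV.
  - exact: periodic_continuous_bounded.
  - by move=> h _; apply/funext => x; exact: Findep.
move=> [Fp [G [cG _ _] GF]] Findep; exists (F^~ 0).
have cF : continuous (F^~ 0).
  rewrite (_ : F^~ 0 = (fun x => G (x, 0))).
    move=> x; apply: (@continuous_comp _ _ _ (pair^~ 0) G); last exact: cG.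
    apply: (@cvg_pair _ _ _ (nbhs x) (nbhs x) (nbhs (0 : R)) _ _ _ id (cst 0)) => //.
    exact: cvg_cst.
  by apply/funext => x; rewrite GF.
split.
- exact: continuous_measurable_rV.
- by apply: periodic_continuous_bounded => //; exact: Fp.
- by move=> h [_ _ h0 _]; apply/funext => x; apply: Findep.
Qed.

End cost_regularity.

(* The integral is the supremum over simple functions below the integrand, so
   no measurability is required. *)
Lemma ge0_le_integral_nonmeasurable (dd : measure_display)
    (X : measurableType dd) (R : realType) (mu : {measure set X -> \bar R})
    (D : set X) (f g : X -> \bar R) :
  (forall x, D x -> 0 <= f x)%E -> (forall x, D x -> f x <= g x)%E ->
  (\int[mu]_(x in D) f x <= \int[mu]_(x in D) g x)%E.
Proof.
move=> f0 fg; have g0 x : D x -> (0 <= g x)%E.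
  by move=> Dx; exact: le_trans (f0 x Dx) (fg x Dx).
rewrite !ge0_integralE//; apply: le_ereal_sup => _ [h hf <-]; exists h => //= x.
by apply: le_trans (hf x) _; apply: lee_restrict.
Qed.

(** The negative part of [f] is at most that of [g], so its integral is finite; the positive part
    can only contribute [+oo]. *)
Lemma integral_gtNy_lower_bound (dd : measure_display)
    (X : measurableType dd) (R : realType) (mu : {measure set X -> \bar R})
    (D : set X) (f : X -> \bar R) (g : X -> R) :
  measurable D ->
  mu.-integrable D (EFin \o g) -> (forall x, D x -> (g x)%:E <= f x)%E ->
  (-oo < \int[mu]_(x in D) f x)%E.
Proof.
move=> mD intg gf; rewrite integralE.
have fpos : (0 <= \int[mu]_(x in D) f^\+ x)%E by exact: integral_ge0.
have fneg : (\int[mu]_(x in D) f^\- x < +oo)%E.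
  apply: le_lt_trans (integral_funeneg_lt_pinfty mD intg).
  apply: ge0_le_integral_nonmeasurable => // x Dx.
  rewrite !funenegE ge_max !le_max lexx orbT andbT leeN2.
  by rewrite (gf x Dx).
have fneg0 : (0 <= \int[mu]_(x in D) f^\- x)%E by exact: integral_ge0.
rewrite -(fineK (_ : \int[mu]_(x in D) f^\- x \is a fin_num)%E); last first.
  by rewrite ge0_fin_numE.
case: (\int[mu]_(x in D) f^\+ x)%E fpos => // r _.
by rewrite -EFinB ltNyr.
Qed.

(** * The constraint set *)

Section constraint_set.
Variables (R : realType) (d : nat) (D : mfg R d).
Hypothesis hD : standing_assumptions D.
Let T := horizon D.
Implicit Types (r psi : 'rV[R]_d * R -> R) (m : 'rV[R]_d * R -> 'rV[R]_d).

(** Testing the supremum in [lagrangian] with [p = 0] gives [L(x, v) >= - H(x, 0)], and [H(., 0)] is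
    bounded by periodicity. The integrand thus dominates the integrable function [- M * r]. *)
Lemma dynamic_cost_gtNy r m : density_evolution T r ->
  (-oo < dynamic_cost D r m)%E.
Proof.
move=> rP.
have [_ _ [Hp _ _ _ _] _ _] := hD.
have [M HM] := periodic_continuous_bounded (Hp 0) (ham_continuous hD (p := 0)).
have intr := density_evolution_integrable rP.
apply: (@integral_gtNy_lower_bound _ _ R (lebQ R d) _ _ (fun z => - M * r z)).
- exact: measurable_cyl.
- by apply: (integrableZl _ (- M) intr); exact: measurable_cyl.
- move=> [x t] zP; have r0 := density_evolution_ge0 rP zP.
  have M0 : 0 <= M by apply: le_trans (HM x).
  rewrite /dynamic_density; case: eqP => [->|/eqP rn0].
    by rewrite mulr0; case: ifP => //; rewrite leey.
  have rpos : 0 < r (x, t) by rewrite lt_def rn0.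
  rewrite /= mulrC EFinM lee_pmul2l//.
  apply: (@le_trans _ _ (- dotp 0 ((r (x, t))^-1 *: m (x, t)) - ham D x 0)%:E).
    rewrite lee_fin /dotp big1 => [|i _]; last by rewrite mxE mul0r.
    by rewrite oppr0 add0r lerN2 (le_trans (ler_norm _)).
  by apply: ereal_sup_ubound; exists 0.
Qed.

Lemma density_evolution_convex s r0 r1 : 0 <= s <= 1 ->
  density_evolution T r0 -> density_evolution T r1 ->
  density_evolution T (fun z => (1 - s) * r0 z + s * r1 z).
Proof.
move=> /andP[s0 s1] [mr0 d0 c0] [mr1 d1 c1].
have s1' : 0 <= 1 - s by rewrite subr_ge0.
split.
- by apply: measurable_funD; apply: measurable_funM.
- move=> t t0T; have [p0 m0 ge0 i0] := d0 t t0T; have [p1 m1 ge1 i1] := d1 t t0T.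
  have em0 : measurable_fun setT (fun x => ((slice r0 t x))%:E).
    exact/measurable_EFinP.
  have em1 : measurable_fun setT (fun x => ((slice r1 t x))%:E).
    exact/measurable_EFinP.
  split.
  + move=> i x; rewrite /slice.
    by have := p0 i x; have := p1 i x; rewrite /slice => -> ->.
  + by apply: measurable_funD; apply: measurable_funM.
  + by move=> x; apply: addr_ge0; apply: mulr_ge0 => //; [exact: ge0|exact: ge1].
  + under eq_integral do rewrite /slice EFinD !EFinM.
    rewrite ge0_integralD//=.
    * rewrite !ge0_integralZl_EFin//.
        by rewrite i0 i1 !mule1 -EFinD subrK.
      by move=> x _; rewrite lee_fin; exact: ge1.
      by move=> x _; rewrite lee_fin; exact: ge0.
    * by move=> x _; rewrite -EFinM lee_fin mulr_ge0//; exact: ge0.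
    * exact: measurable_funeM.
    * by move=> x _; rewrite -EFinM lee_fin mulr_ge0//; exact: ge1.
    * exact: measurable_funeM.
- move=> t t0T.
  pose a (r : 'rV[R]_d * R -> R) u :=
    (\int[leb R d]_x (`|r (x, u) - r (x, t)|)%:E)%E.
  have cvgab : ((1 - s)%:E * a r0 u + s%:E * a r1 u)%E
      @[u --> within `[0, T]%classic (nbhs t)] --> 0%E.
    rewrite -[X in _ --> X]adde0 -[X in _ --> (X + _)%E](mule0 (1 - s)%:E).
    rewrite -[X in _ --> (_ + X)%E](mule0 s%:E).
    apply: cvgeD; first by rewrite !mule0.
      by apply: cvgeZl => //; exact: c0.
    by apply: cvgeZl => //; exact: c1.
  apply: (squeeze_cvge _ (cvg_cst 0%E) cvgab).
  near=> u; apply/andP; split; first by apply: integral_ge0.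
  have u0T : 0 <= u <= T.
    suff : `[0, T]%classic u by rewrite /= in_itv.
    by near: u; apply: withinT.
  have mdiff (r : 'rV[R]_d * R -> R)
      (rd : forall t, 0 <= t <= T -> is_density (slice r t)) :
      measurable_fun setT (fun x => (`|r (x, u) - r (x, t)|)%:E).
    have [_ mu _ _] := rd u u0T; have [_ mt _ _] := rd t t0T.
    apply/measurable_EFinP; apply: measurableT_comp => //.
    exact: measurable_funB mu mt.
  have m0 := mdiff r0 d0; have m1 := mdiff r1 d1.
  have <- : (\int[leb R d]_x ((1 - s)%:E * (`|r0 (x, u) - r0 (x, t)|)%:E
      + s%:E * (`|r1 (x, u) - r1 (x, t)|)%:E) =
      (1 - s)%:E * a r0 u + s%:E * a r1 u)%E.
    rewrite ge0_integralD//=.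
    - by rewrite !ge0_integralZl_EFin.
    - by move=> x _; rewrite -EFinM lee_fin mulr_ge0.
    - exact: measurable_funeM.
    - by move=> x _; rewrite -EFinM lee_fin mulr_ge0.
    - exact: measurable_funeM.
  apply: ge0_le_integral_nonmeasurable => // x _.
  rewrite -!EFinM -EFinD lee_fin.
  rewrite (_ : _ - _ = (1 - s) * (r0 (x, u) - r0 (x, t))
     + s * (r1 (x, u) - r1 (x, t))); last by ring.
  by rewrite (le_trans (ler_normD _ _))// !normrM !(ger0_norm s0) (ger0_norm s1').
Unshelve. all: by end_near. Qed.

Lemma L1_momentum_convex s m0 m1 : L1_momentum T m0 -> L1_momentum T m1 ->
  L1_momentum T (fun z => (1 - s) *: m0 z + s *: m1 z).
Proof.
move=> [p0 i0] [p1 i1]; split.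
  move=> t t0T i x; have := p0 t t0T i x; have := p1 t t0T i x.
  by rewrite /slice => -> ->.
move=> i.
have mD := @measurable_cylbar R d T.
have := @integrable_lincomb _ _ R (lebQ R d) _ mD _ _ (1 - s) s (i0 i) (i1 i).
by apply: eq_integrable => // z _; rewrite !mxE.
Qed.

(** The difference quotients at [x] and at [x + e_i] are the same function of the increment. *)
Lemma derive_periodic (F : 'rV[R]_d * R -> R) v :
  (forall t, periodic (slice F t)) -> forall t, periodic (slice ('D_v F) t).
Proof.
move=> Fp t i x; rewrite /slice /derive.
set a := (x + delta_mx ord0 i, t); set b := (x, t).
have shiftE w : F (w + a) = F (w + b).
  case: w => y s; rewrite /a /b.
  have -> : (y, s) + (x + delta_mx ord0 i, t) = (y + x + delta_mx ord0 i, s + t).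
    by congr pair; exact: addrA.
  exact: Fp.
have -> : (fun h : R => h^-1 *: ((F \o shift a) (h *: v) - F a)) =
    (fun h : R => h^-1 *: ((F \o shift b) (h *: v) - F b)).
  by apply/funext => h /=; rewrite shiftE -[a]add0r shiftE add0r.
by [].
Qed.

Lemma test_function_coefficients psi : test_function D psi ->
  [/\ continuous (fun z => dt psi z + visc D * lap psi z),
    forall t, periodic (slice (fun z => dt psi z + visc D * lap psi z) t) &
    forall i, continuous ('D_(dir R i) psi) /\
      forall t, periodic (slice ('D_(dir R i) psi) t)].
Proof.
move=> [psis psip _]; have [_ _ psi1] := psis 2.
have cdt : continuous (dt psi) by have [] := psi1 (0, 1).
have clap i : continuous ('D_(dir R i) ('D_(dir R i) psi)).
  by have [_ _ /(_ (dir R i))] := psi1 (dir R i).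
split.
- move=> z; apply: cvgD; first exact: cdt.
  apply: cvgM; first exact: cvg_cst.
  by apply: cvg_sumr => i; exact: clap.
- move=> t i x; rewrite /slice; congr (_ + _ * _).
    exact: derive_periodic.
  by apply: eq_bigr => j _; do 2 apply: derive_periodic => //.
- by move=> i; split; [have [] := psi1 (dir R i)|exact: derive_periodic].
Qed.

(** Needed to split the weak formulation linearly in the pair [(r, m)]. The derivatives of [psi] are
    continuous and periodic, hence bounded on the cylinder. *)
Lemma continuity_eq_integrable r m psi : density_evolution T r ->
  L1_momentum T m -> test_function D psi ->
  (lebQ R d).-integrable (cyl d T) (EFin \o (fun z =>
    r z * (dt psi z + visc D * lap psi z) + dotp (m z) (grad psi z))).
Proof.
move=> rP [_ mP] psiP.
have mC := @measurable_cyl R d T.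
have [cG pG cdir] := test_function_coefficients psiP.
have bounded (G : 'rV[R]_d * R -> R) : continuous G ->
    (forall t, periodic (slice G t)) -> forall h,
    (lebQ R d).-integrable (cyl d T) (EFin \o h) ->
    (lebQ R d).-integrable (cyl d T) (fun z => (h z * G z)%:E).
  move=> cG' pG' h hint.
  have [M MP] := @periodic_continuous_bounded_cyl R d T G G (fun t _ => pG' t)
    cG' (fun _ _ _ => erefl).
  have mG : measurable_fun (cyl d T) G.
    by apply: measurable_funTS; exact: continuous_measurable_rV_R.
  have := @integrable_bounded_mul _ _ R (lebQ R d) _ _ _ M mC mG MP hint.
  by apply: eq_integrable => // z _; rewrite mulrC.
have int1 := bounded _ cG pG _ (density_evolution_integrable rP).
have int2 : (lebQ R d).-integrable (cyl d T)
    (EFin \o (fun z => dotp (m z) (grad psi z))).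
  have := @integrable_sum _ _ R (lebQ R d) _ mC _ (index_enum 'I_d) xpredT
    (fun i z => (m z ord0 i * 'D_(dir R i) psi z)%:E).
  move=> /(_ _)/wrap[i _|].
    have [cd pd] := cdir i; apply: (bounded _ cd pd (fun z => m z ord0 i)).
    apply: (@integrableS _ _ R (lebQ R d) (cylbar d T)) => //.
    - exact: measurable_cylbar.
    - exact: cyl_cylbar.
    - exact: mP.
  apply: eq_integrable => // z _; rewrite /= /dotp -sumEFin.
  by apply: eq_bigr => i _; rewrite mxE.
have := @integrable_lincomb _ _ R (lebQ R d) _ mC _ _ 1 1 int1 int2.
by apply: eq_integrable => // z _; rewrite !mul1r.
Qed.

Lemma continuity_eq_convex s r0 m0 r1 m1 :
  density_evolution T r0 -> density_evolution T r1 ->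
  L1_momentum T m0 -> L1_momentum T m1 ->
  continuity_eq D r0 m0 -> continuity_eq D r1 m1 ->
  continuity_eq D (fun z => (1 - s) * r0 z + s * r1 z)
    (fun z => (1 - s) *: m0 z + s *: m1 z).
Proof.
move=> d0 d1 l0 l1 c0 c1 psi psiP.
have mC := @measurable_cyl R d T.
have := @integral_lincomb _ _ R (lebQ R d) _ mC _ _ (1 - s) s
  (continuity_eq_integrable d0 l0 psiP) (continuity_eq_integrable d1 l1 psiP).
rewrite c0// c1// !mule0 adde0 => <-.
apply: eq_integral => z _; congr EFin.
have -> : dotp ((1 - s) *: m0 z + s *: m1 z) (grad psi z) =
    (1 - s) * dotp (m0 z) (grad psi z) + s * dotp (m1 z) (grad psi z).
  rewrite /dotp !mulr_sumr -big_split/=; apply: eq_bigr => i _.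
  by rewrite !mxE; ring.
ring.
Qed.

Lemma constraint_convex s r0 m0 r1 m1 : 0 <= s <= 1 ->
  constraint D r0 m0 -> constraint D r1 m1 ->
  constraint D (fun z => (1 - s) * r0 z + s * r1 z)
    (fun z => (1 - s) *: m0 z + s *: m1 z).
Proof.
move=> s01 [d0 l0 i0 c0] [d1 l1 i1 c1]; split.
- exact: density_evolution_convex.
- exact: L1_momentum_convex.
- apply: filterS2 i0 i1 => x -> ->.
  by rewrite -mulrDl subrK mul1r.
- exact: continuity_eq_convex.
Qed.

End constraint_set.

(** * Square norms and Young's inequality *)

Section square_norms.
Context (dd : measure_display) (X : measurableType dd) (R : realType).
Variable mu : {measure set X -> \bar R}.

Lemma Lnorm2_square (h : X -> R) :
  ('N[mu]_2%:E[EFin \o h] `^ 2 = \int[mu]_x (h x ^+ 2)%:E)%E.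
Proof.
rewrite poweR_Lnorm ?pnatr_eq0//; apply: eq_integral => x _ /=.
by rewrite powR_mulrn// real_normK// num_real.
Qed.

Lemma Lnorm2_fin_square (h : X -> R) : ('N[mu]_2%:E[EFin \o h] < +oo)%E ->
  (\int[mu]_x (h x ^+ 2)%:E = (fine 'N[mu]_2%:E[EFin \o h] ^+ 2)%:E)%E.
Proof.
move=> hoo; rewrite -Lnorm2_square.
have N0 := @Lnorm_ge0 _ _ _ mu 2%:E (EFin \o h).
rewrite -[in LHS](fineK (_ : 'N[mu]_2%:E[EFin \o h] \is a fin_num)%E).
  by rewrite poweR_EFin powR_mulrn// fine_ge0.
by rewrite ge0_fin_numE.
Qed.

Lemma Lnorm2_lty (h : X -> R) : (\int[mu]_x (h x ^+ 2)%:E < +oo)%E ->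
  ('N[mu]_2%:E[EFin \o h] < +oo)%E.
Proof.
rewrite -Lnorm2_square; case: Lnorm => [r| |//]; first by move=> _; exact: ltry.
by rewrite poweRyr ?pnatr_eq0.
Qed.

Lemma integrable_square (D : set X) (h : X -> R) : measurable D ->
  measurable_fun D h ->
  (\int[mu]_(x in D) (h x ^+ 2)%:E < +oo)%E ->
  mu.-integrable D (EFin \o (fun x => h x ^+ 2)).
Proof.
move=> mD mh hoo; apply/integrableP; split.
  by apply/measurable_EFinP; exact: measurable_funX.
by under eq_integral do rewrite /= ger0_norm ?sqr_ge0//.
Qed.

(** Integrate the expansion of [lam^-1 / 2 * (f - lam * g) ^+ 2 >= 0]. The weight [lam / 2] on the
    square of [g] is the one that strong convexity later absorbs. *)
Lemma integral_young (D : set X) (f g : X -> R) (lam : R) : measurable D ->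
  0 < lam ->
  mu.-integrable D (EFin \o (fun x => f x * g x)) ->
  mu.-integrable D (EFin \o (fun x => f x ^+ 2)) ->
  mu.-integrable D (EFin \o (fun x => g x ^+ 2)) ->
  (\int[mu]_(x in D) (f x * g x)%:E <=
    (lam^-1 / 2)%:E * \int[mu]_(x in D) (f x ^+ 2)%:E +
    (lam / 2)%:E * \int[mu]_(x in D) (g x ^+ 2)%:E)%E.
Proof.
move=> mD lam0 intfg intf intg; rewrite -integral_lincomb//.
apply: le_integral => //; first exact: integrable_lincomb.
move=> x _; rewrite lee_fin.
have : 0 <= lam^-1 / 2 * (f x - lam * g x) ^+ 2.
  by rewrite mulr_ge0 ?sqr_ge0// divr_ge0// invr_ge0 ltW.
rewrite (_ : lam^-1 / 2 * (f x - lam * g x) ^+ 2 = lam^-1 / 2 * f x ^+ 2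
  + lam / 2 * g x ^+ 2 - f x * g x); first by rewrite subr_ge0.
by field; rewrite gt_eqF.
Qed.

End square_norms.

(** * Lipschitz and monotonicity estimates on space-time *)

Section coupling_estimates.
Variables (R : realType) (d : nat) (D : mfg R d).
Hypothesis hD : standing_assumptions D.
Let T := horizon D.
Implicit Types (r : 'rV[R]_d * R -> R).

Lemma normQ_square (h : 'rV[R]_d * R -> R) : (normQ T h < +oo)%E ->
  (\int[lebQ R d]_(z in cyl d T) (h z ^+ 2)%:E = (fine (normQ T h) ^+ 2)%:E)%E.
Proof.
rewrite /normQ; have -> : (EFin \o h) \_ (cyl d T) = EFin \o (h \_ (cyl d T)).
  by apply/funext => z; rewrite /= !patchE; case: ifP.
move=> /(@Lnorm2_fin_square _ _ R (lebQ R d)) <-.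
rewrite [LHS]integral_mkcond; congr integral; apply/funext => z.
rewrite /= !patchE; case: ifP => //.
by rewrite expr0n.
Qed.

Variables r r' : 'rV[R]_d * R -> R.
Hypotheses (rP : density_evolution T r) (r'P : density_evolution T r').
Hypotheses (rreg : regular_evolution D r) (r'reg : regular_evolution D r').
Let dc z := cost_along D r z - cost_along D r' z.
Let dr z := r z - r' z.

Lemma measurable_cost_diff : measurable_fun (cyl d T) dc.
Proof.
by apply: measurable_funB; [have [] := regular_cost_bounded hD rP rreg|
  have [] := regular_cost_bounded hD r'P r'reg].
Qed.

Lemma measurable_evolution_diff : measurable_fun (cyl d T) dr.
Proof. by apply: measurable_funB; exact: density_evolution_measurable. Qed.

Lemma integrable_cost_diff_mul h :
  (lebQ R d).-integrable (cyl d T) (EFin \o h) ->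
  (lebQ R d).-integrable (cyl d T) (EFin \o (fun z => dc z * h z)).
Proof.
move=> inth; have mC := @measurable_cyl R d T.
have := @integrable_lincomb _ _ R (lebQ R d) _ mC _ _ 1 (- 1)
  (integrable_cost_mul hD rP rreg inth) (integrable_cost_mul hD r'P r'reg inth).
by apply: eq_integrable => // z _; rewrite /dc /=; congr EFin; ring.
Qed.

(** For a local cost the bound is pointwise. For a nonlocal one it is the hypothesis on each time
    slice, with [dr] as the density of the difference of the measures, integrated over time by
    Tonelli. *)
Lemma coupling_lipschitz_Q Lf : coupling_lipschitz Lf (cost D) ->
  (\int[lebQ R d]_(z in cyl d T) (dr z ^+ 2)%:E < +oo)%E ->
  (\int[lebQ R d]_(z in cyl d T) (dc z ^+ 2)%:E <=
   (Lf ^+ 2)%:E * \int[lebQ R d]_(z in cyl d T) (dr z ^+ 2)%:E)%E.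
Proof.
have mC := @measurable_cyl R d T.
have mdr2 : measurable_fun (cyl d T) (fun z => (dr z ^+ 2)%:E).
  by apply/measurable_EFinP; apply: measurable_funX; exact: measurable_evolution_diff.
have mdc2 : measurable_fun (cyl d T) (fun z => (dc z ^+ 2)%:E).
  by apply/measurable_EFinP; apply: measurable_funX; exact: measurable_cost_diff.
case E : (cost D) => [F|F] /= Lip dr2oo; last first.
  have dr2_ge0 z : cyl d T z -> (0 <= (dr z ^+ 2)%:E)%E by rewrite lee_fin sqr_ge0.
  rewrite -(@ge0_integralZl_EFin _ _ R (lebQ R d) _ mC _ dr2_ge0 mdr2 _ (sqr_ge0 Lf)).
  apply: (@ge0_le_integral_nonmeasurable _ _ R (lebQ R d)) => z zP.
    by rewrite lee_fin sqr_ge0.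
  rewrite -EFinM lee_fin -(real_normK (num_real (dc z))).
  rewrite -(real_normK (num_real (dr z))) -exprMn ler_sqr ?nnegrE//.
    rewrite /dc /cost_along /coupling_at E; case: z zP => x t zP.
    by apply: Lip; [exact: density_evolution_ge0 rP zP|
      exact: density_evolution_ge0 r'P zP].
  apply: le_trans (normr_ge0 (F z.1 (r z) - F z.1 (r' z))) _; apply: Lip.
    exact: density_evolution_ge0 rP zP.
  exact: density_evolution_ge0 r'P zP.
rewrite tonelli_cyl//; last by move=> z _; rewrite lee_fin sqr_ge0.
move: dr2oo; rewrite tonelli_cyl//; last by move=> z _; rewrite lee_fin sqr_ge0.
have sq0 (k : 'rV[R]_d * R -> R) t : (0 <= \int[leb R d]_x (k (x, t) ^+ 2)%:E)%E.
  by apply: integral_ge0 => x _; rewrite lee_fin sqr_ge0.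
have mI : measurable_fun `]0%R, T[ (fun t => \int[leb R d]_x (dr (x, t) ^+ 2)%:E)%E.
  by apply: (@measurable_slice_integral R d T (fun z => (dr z ^+ 2)%:E)) => // z _;
    rewrite lee_fin sqr_ge0.
move=> dr2oo; rewrite -ge0_integralZl_EFin//; last exact: sqr_ge0.
apply: ae_ge0_le_integral => //.
- by apply: (@measurable_slice_integral R d T (fun z => (dc z ^+ 2)%:E)) => // z _;
    rewrite lee_fin sqr_ge0.
- by move=> t _; rewrite mule_ge0// lee_fin sqr_ge0.
- exact: measurable_funeM.
(* The Lipschitz hypothesis asks for a square-integrable difference of densities; finiteness of the
   space-time integral provides it for almost every [t]. *)
have : lebesgue_measure.-integrable `]0%R, T[
    (fun t => \int[leb R d]_x (dr (x, t) ^+ 2)%:E)%E.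
  apply/integrableP; split => //.
  by under eq_integral do rewrite gee0_abs//.
move=> /integrable_ae => /(_ _)/wrap[//|]; apply: filterS => t tfin tP.
have t0T : 0 < t < T by move: tP; rewrite /= in_itv.
have {}tfin := tfin tP.
have rd : is_density (slice r t) by case: rP => _ /(_ t (ltW_itv t0T)).
have r'd : is_density (slice r' t) by case: r'P => _ /(_ t (ltW_itv t0T)).
have [_ mr _ _] := rd; have [_ mr' _ _] := r'd.
have normdr : (normT (fun x => dr (x, t)) < +oo)%E.
  by apply: Lnorm2_lty; rewrite -ge0_fin_numE.
have mdrt : measurable_fun setT (fun x => dr (x, t)) by exact: measurable_funB mr mr'.
have := Lip (prob_of_density (slice r t)) (prob_of_density (slice r' t))
  (fun x => dr (x, t)) mdrt normdr.
move=> /(_ _)/wrap[A mA|].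
  rewrite (prob_of_densityP rd)// (prob_of_densityP r'd)//.
  have rint := integrableS measurableT mA (@subsetT _ A) (is_density_integrable rd).
  have r'int := integrableS measurableT mA (@subsetT _ A) (is_density_integrable r'd).
  by rewrite -integralB//; apply: eq_integral => x _; rewrite EFinB.
rewrite (_ : (fun x => F x _ - F x _) = (fun x => dc (x, t))); last first.
  by apply/funext => x; rewrite /dc /cost_along /coupling_at E.
have ndr : normT (fun x => dr (x, t)) \is a fin_num.
  by rewrite ge0_fin_numE// Lnorm_ge0.
rewrite -(fineK ndr) -EFinM => le1.
have normdc : (normT (fun x => dc (x, t)) < +oo)%E := le_lt_trans le1 (ltry _).
rewrite (Lnorm2_fin_square normdr) (Lnorm2_fin_square normdc) -EFinM lee_fin.
rewrite -exprMn; move: le1.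
rewrite -(fineK (_ : normT (fun x => dc (x, t)) \is a fin_num)).
  have ndc0 : 0 <= fine (normT (fun x => dc (x, t))) by exact/fine_ge0/Lnorm_ge0.
  rewrite lee_fin => le1; rewrite ler_sqr// nnegrE//.
  exact: le_trans le1.
by rewrite ge0_fin_numE// Lnorm_ge0.
Qed.

(** In the local case the two factors never have opposite signs. In the nonlocal case the integral
    on each slice is the difference of the integrals of [G] against the two measures, which is the
    monotonicity pairing. *)
Lemma coupling_monotone_Q : coupling_monotone (cost D) ->
  (0 <= \int[lebQ R d]_(z in cyl d T) (dc z * dr z)%:E)%E.
Proof.
case E : (cost D) => [F|F] /= mono; last first.
  apply: integral_ge0 => z zP; rewrite lee_fin /dc /dr /cost_along /coupling_at E.
  case: z zP => x t zP.
  have r0 := density_evolution_ge0 rP zP; have r'0 := density_evolution_ge0 r'P zP.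
  rewrite /slice/=; have [rr'|/ltW r'r] := leP (r (x, t)) (r' (x, t)).
    by rewrite -mulrNN mulr_ge0// oppr_ge0 subr_le0//; exact: mono.
  by rewrite mulr_ge0// subr_ge0//; exact: mono.
have mC := @measurable_cyl R d T.
have int_dr : (lebQ R d).-integrable (cyl d T) (EFin \o dr).
  have := @integrable_lincomb _ _ R (lebQ R d) _ mC _ _ 1 (- 1)
    (density_evolution_integrable rP) (density_evolution_integrable r'P).
  by apply: eq_integrable => // z _; rewrite /dr /=; congr EFin; ring.
rewrite fubini_cyl; last exact: integrable_cost_diff_mul.
apply: integral_ge0 => t; rewrite /= in_itv/= => t0T.
have rd : is_density (slice r t) by case: rP => _ /(_ t (ltW_itv t0T)).
have r'd : is_density (slice r' t) by case: r'P => _ /(_ t (ltW_itv t0T)).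
pose mu := prob_of_density (slice r t); pose mu' := prob_of_density (slice r' t).
pose G x := F x mu - F x mu'.
have [_ _ _ + _] := hD; rewrite E /= => FP.
have cG : continuous G.
  have [_ [cF _ _]] := FP mu; have [_ [cF' _ _]] := FP mu'.
  by move=> x; exact: (cvgB (cF x) (cF' x)).
have pG : periodic G.
  have [pF _] := FP mu; have [pF' _] := FP mu'.
  by move=> i x; rewrite /G pF pF'.
have [M GM] := periodic_continuous_bounded pG cG.
have mG := continuous_measurable_rV cG.
have intG (nu : torus_prob R d) : nu.-integrable setT (EFin \o G).
  have := @integrable_bounded_mul _ _ R nu setT G (cst 1) M measurableT mG
    (fun x _ => GM x).
  move=> /(_ _)/wrap[|]; last by apply: eq_integrable => // x _; rewrite mulr1.
  exact: finite_measure_integrable_cst.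
have := mono mu mu'.
have [_ mr r0 _] := rd; have [_ mr' r'0 _] := r'd.
rewrite (integral_has_density mr r0 (prob_of_densityP rd) (intG _)).
rewrite (integral_has_density mr' r'0 (prob_of_densityP r'd) (intG _)).
have int_r := @integrable_bounded_mul _ _ R (leb R d) setT G _ M measurableT mG
    (fun x _ => GM x) (is_density_integrable rd).
have int_r' := @integrable_bounded_mul _ _ R (leb R d) setT G _ M measurableT mG
    (fun x _ => GM x) (is_density_integrable r'd).
rewrite -integralB//=; move=> /le_trans; apply.
rewrite le_eqVlt; apply/orP; left; apply/eqP; apply: eq_integral => x _.
rewrite /dc /dr /cost_along /coupling_at E -EFinM -EFinB; congr EFin.
by rewrite /slice /G/=; ring.
Qed.

End coupling_estimates.

(** * Strong convexity on the unit interval *)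

(** Cancel [A] against [(1 - s) * A], divide by [s] and let [s] tend to [0]. *)
Lemma quadratic_growth_of_interpolation (R : realFieldType) (A B m : R) :
  (forall s, 0 < s < 1 -> A <= (1 - s) * A + s * B - m * s * (1 - s)) ->
  A + m <= B.
Proof.
move=> interp; apply/ler_addgt0Pr => e e0.
(* The first bound keeps [s] below [1], the second makes the leftover [m * s] at most [e]. *)
pose s := Num.min (2^-1) (e / (`|m| + 1)).
have m1 : 0 < `|m| + 1 by rewrite ltr_wpDl.
have s0 : 0 < s by rewrite lt_min invr_gt0 ltr0n divr_gt0.
have sh : s <= 2^-1 by rewrite ge_min lexx.
have se : s * (`|m| + 1) <= e by rewrite -ler_pdivlMr// ge_min lexx orbT.
have ms : m * s <= e.
  have := ler_norm m; have := normr_ge0 m; nra.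
have := interp s; rewrite s0 /= => /(_ _)/wrap[|ineq]; first by lra.
have : s * (A + m) <= s * (B + m * s) by nra.
by rewrite ler_pM2l//; lra.
Qed.

(** Convexity of [y s - mu / 2 * s ^+ 2] between [0] and [1] leaves the deficit
    [mu / 2 * s * (1 - s)]. The resulting upper bound excludes [y s = +oo], the last hypothesis
    excludes [-oo]. *)
Lemma strongly_convex01_interp (R : realType) (mu s a b : R) (y : R -> \bar R) :
  strongly_convex01 mu y -> 0 <= s <= 1 -> y 0 = a%:E -> y 1 = b%:E ->
  (-oo < y s)%E ->
  exists2 c, y s = c%:E & c <= (1 - s) * a + s * b - mu / 2 * s * (1 - s).
Proof.
move=> yc s01 y0 y1; have := yc 0 1 s.
rewrite !lexx ler01 => /(_ isT isT s01); rewrite mulr0 add0r mulr1 y0 y1.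
rewrite -!EFinB -!EFinM -EFinD; case: (y s) => // c le1 _; exists c => //.
move: le1; rewrite -EFinB lee_fin; lra.
Qed.

(** * One step of fictitious play *)

Section game.
Variables (R : realType) (d : nat) (D : mfg R d).
Hypothesis hD : standing_assumptions D.
Let T := horizon D.
Implicit Types (r a u b w h : 'rV[R]_d * R -> R) (m : 'rV[R]_d * R -> 'rV[R]_d).

(** By [running_costE], [fine] loses nothing when [r] is a regular density evolution and [h] is
    integrable. *)
Definition running_cost r h : R := fine (innerQ T (cost_along D r) h).

Lemma running_costE r h : density_evolution T r -> regular_evolution D r ->
  (lebQ R d).-integrable (cyl d T) (EFin \o h) ->
  innerQ T (cost_along D r) h = (running_cost r h)%:E.
Proof.
move=> rP rreg inth; rewrite /running_cost fineK//.
apply: (@integrable_fin_num _ _ R (lebQ R d)); first exact: measurable_cyl.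
exact: integrable_cost_mul.
Qed.

Lemma running_cost_lincomb r h0 h1 (p q : R) : density_evolution T r ->
  regular_evolution D r ->
  (lebQ R d).-integrable (cyl d T) (EFin \o h0) ->
  (lebQ R d).-integrable (cyl d T) (EFin \o h1) ->
  running_cost r (fun z => p * h0 z + q * h1 z) =
  p * running_cost r h0 + q * running_cost r h1.
Proof.
move=> rP rreg int0 int1; have mC := @measurable_cyl R d T.
apply: EFin_inj; rewrite -running_costE//; last first.
  exact: (@integrable_lincomb _ _ R (lebQ R d)).
rewrite EFinD !EFinM -!running_costE//.
have := @integral_lincomb _ _ R (lebQ R d) _ mC _ _ p q
  (integrable_cost_mul hD rP rreg int0) (integrable_cost_mul hD rP rreg int1).
rewrite /innerQ => <-; congr integral; apply/funext => z; congr EFin.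
by rewrite /=; ring.
Qed.

Variable psi : 'rV[R]_d -> R.
Hypothesis mpsi : measurable_fun setT psi.
Variable Mpsi : R.
Hypothesis psi_bounded : forall x, `|psi x| <= Mpsi.
Hypothesis costTE : forall h : 'rV[R]_d -> R,
  is_density h -> coupling_at (costT D) h = psi.

Definition terminal h : R := fine (innerT psi (slice h T)).

Let horizon_ge0 : 0 <= T <= T.
Proof. by have [[/ltW -> _] _ _ _ _] := hD; rewrite lexx. Qed.

Lemma integrable_terminal h : density_evolution T h ->
  (leb R d).-integrable setT (EFin \o (fun x => psi x * slice h T x)).
Proof.
case=> _ /(_ T horizon_ge0) hd _.
exact: integrable_bounded_mul (fun x _ => psi_bounded x) (is_density_integrable hd).
Qed.

Lemma terminalE h : density_evolution T h ->
  innerT psi (slice h T) = (terminal h)%:E.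
Proof.
move=> hP; rewrite /terminal fineK//.
by apply: integrable_fin_num => //; exact: integrable_terminal.
Qed.

Lemma terminal_convex h0 h1 s : 0 <= s <= 1 -> density_evolution T h0 ->
  density_evolution T h1 ->
  terminal (fun z => (1 - s) * h0 z + s * h1 z) =
  (1 - s) * terminal h0 + s * terminal h1.
Proof.
move=> s01 h0P h1P; apply: EFin_inj.
rewrite -terminalE; last exact: density_evolution_convex.
rewrite EFinD !EFinM -!terminalE//.
have := integral_lincomb measurableT (1 - s) s
  (integrable_terminal h0P) (integrable_terminal h1P).
rewrite /innerT => <-; apply: eq_integral => x _; congr EFin.
by rewrite /slice /=; ring.
Qed.

Definition linear_cost r h : R := running_cost r h + terminal h.

Lemma JE r h m : density_evolution T r -> regular_evolution D r ->
  density_evolution T h ->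
  J D h m r = (dynamic_cost D h m + (linear_cost r h)%:E)%E.
Proof.
move=> rP rreg hP; rewrite /J costTE; last by case: rP => _ /(_ T horizon_ge0).
rewrite terminalE// running_costE//; last exact: density_evolution_integrable.
by rewrite -addeA -EFinD.
Qed.

Lemma linear_cost_convex r h0 h1 s : density_evolution T r ->
  regular_evolution D r -> 0 <= s <= 1 -> density_evolution T h0 ->
  density_evolution T h1 ->
  linear_cost r (fun z => (1 - s) * h0 z + s * h1 z) =
  (1 - s) * linear_cost r h0 + s * linear_cost r h1.
Proof.
move=> rP rreg s01 h0P h1P; rewrite /linear_cost terminal_convex//.
rewrite running_cost_lincomb//; [ring|exact: density_evolution_integrable|].
exact: density_evolution_integrable.
Qed.

Lemma gain_minimizer r m u mu : minimizer D u mu r ->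
  gain D r m = (J D r m r - J D u mu r)%E.
Proof.
move=> [uC umin]; congr (_ - _)%E; apply/eqP; rewrite eq_le; apply/andP; split.
  by apply: ereal_inf_lbound; exists (u, mu).
by apply: le_ereal_inf_tmp => _ [[h mh] /= hC <-]; exact: umin.
Qed.

Lemma directional_interp lam a ma u mu Ra Ru s :
  directional_strongly_convex D lam a ma u mu ->
  constraint D a ma -> constraint D u mu ->
  dynamic_cost D a ma = Ra%:E -> dynamic_cost D u mu = Ru%:E -> 0 <= s <= 1 ->
  exists2 c, dynamic_cost D (fun z => (1 - s) * a z + s * u z)
                            (fun z => (1 - s) *: ma z + s *: mu z) = c%:E &
    c <= (1 - s) * Ra + s * Ru
         - lam * fine (normQ T (a \- u)%R) ^+ 2 / 2 * s * (1 - s).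
Proof.
move=> [_ _ yc] aC uC aR uR s01.
apply: (strongly_convex01_interp yc s01) => /=.
- rewrite -aR; congr dynamic_cost; apply/funext => z.
    by rewrite subr0 mul1r mul0r addr0.
  by rewrite subr0 scale1r scale0r addr0.
- rewrite -uR; congr dynamic_cost; apply/funext => z.
    by rewrite subrr mul0r mul1r add0r.
  by rewrite subrr scale0r scale1r add0r.
- apply: dynamic_cost_gtNy => //.
  by have [] := constraint_convex s01 aC uC.
Qed.

(** The minimizer is compared with the points of the segment towards [a]. The remaining cost is
    affine along it, so the deficit [q * s * (1 - s)] of the dynamic cost survives and yields growth
    [q] as [s] tends to [0]. *)
Lemma minimizer_growth q r u mu a ma Ru Ra :
  density_evolution T r -> regular_evolution D r -> minimizer D u mu r ->
  constraint D a ma ->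
  (forall s, 0 <= s <= 1 ->
    exists2 c, dynamic_cost D (fun z => (1 - s) * u z + s * a z)
                              (fun z => (1 - s) *: mu z + s *: ma z) = c%:E &
      c <= (1 - s) * Ru + s * Ra - q * s * (1 - s)) ->
  dynamic_cost D u mu = Ru%:E ->
  Ru + linear_cost r u + q <= Ra + linear_cost r a.
Proof.
move=> rP rreg [uC umin] aC interp uR.
apply: quadratic_growth_of_interpolation => s /ltW_itv s01.
have [c cE le_c] := interp s s01.
have := umin _ _ (constraint_convex s01 uC aC).
have [uP _ _ _] := uC; have [aP _ _ _] := aC.
rewrite !JE//; last exact: density_evolution_convex.
rewrite linear_cost_convex// cE uR -!EFinD lee_fin; lra.
Qed.

(* One iteration: [a] is the current evolution, [u] its best response, [b] the
   next evolution and [w] the best response of [b]. *)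
Section step.
Variables (Lf lam delta : R).
Variables (a u b w : 'rV[R]_d * R -> R).
Variables (ma mu mb mw : 'rV[R]_d * R -> 'rV[R]_d).
Hypotheses (lam0 : 0 < lam) (delta01 : 0 <= delta <= 1).
Hypotheses (aC : constraint D a ma).
Hypotheses (areg : regular_evolution D a) (breg : regular_evolution D b).
Hypotheses (umin : minimizer D u mu a) (wmin : minimizer D w mw b).
Hypothesis bE : b = (fun z => (1 - delta) * a z + delta * u z).
Hypothesis mbE : mb = (fun z => (1 - delta) *: ma z + delta *: mu z).
Hypothesis conv_au : directional_strongly_convex D lam a ma u mu.
Hypothesis conv_uw : directional_strongly_convex D lam u mu w mw.
Hypothesis lip : coupling_lipschitz Lf (cost D).
Hypothesis mono : coupling_monotone (cost D).
Variables (Ra Ru Rw : R).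
Hypothesis aR : dynamic_cost D a ma = Ra%:E.
Hypothesis uR : dynamic_cost D u mu = Ru%:E.
Hypothesis wR : dynamic_cost D w mw = Rw%:E.

Let aP : density_evolution T a. Proof. by case: aC. Qed.
Let uC : constraint D u mu. Proof. by case: umin. Qed.
Let uP : density_evolution T u. Proof. by case: uC. Qed.
Let wC : constraint D w mw. Proof. by case: wmin. Qed.
Let wP : density_evolution T w. Proof. by case: wC. Qed.

Lemma step_constraint : constraint D b mb.
Proof. by rewrite bE mbE; exact: constraint_convex. Qed.

Let bP : density_evolution T b. Proof. by case: step_constraint. Qed.

Let Y := fine (normQ T (a \- u)%R) ^+ 2.
Let X := fine (normQ T (u \- w)%R) ^+ 2.

Lemma step_growth_a :
  Ru + linear_cost a u + lam * Y / 2 <= Ra + linear_cost a a.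
Proof.
apply: (minimizer_growth aP areg umin aC _ uR) => s s01.
(* Strong convexity is given from [a] to [u], whereas growth is measured from [u] to [a]: the
   parameter is reversed. *)
have s01' : 0 <= 1 - s <= 1 by lra.
have [c cE le_c] := directional_interp conv_au aC uC aR uR s01'.
exists c; last by move: le_c; rewrite -/Y; lra.
rewrite -cE; congr dynamic_cost; apply/funext => z; last first.
  by rewrite subKr addrC.
by rewrite subKr addrC.
Qed.

Lemma step_growth_w :
  Ru + linear_cost a u + lam * X / 2 <= Rw + linear_cost a w.
Proof.
apply: (minimizer_growth aP areg umin wC _ uR) => s s01.
exact: directional_interp.
Qed.

(** This is [(F_b - F_a)(h)]: the terminal parts cancel. *)
Let Delta h := running_cost b h - running_cost a h.

Let Delta_integral h : (lebQ R d).-integrable (cyl d T) (EFin \o h) ->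
  (\int[lebQ R d]_(z in cyl d T)
    ((cost_along D b z - cost_along D a z) * h z)%:E = (Delta h)%:E)%E.
Proof.
move=> inth; have mC := @measurable_cyl R d T.
have := @integral_lincomb _ _ R (lebQ R d) _ mC _ _ 1 (- 1)
  (integrable_cost_mul hD bP breg inth) (integrable_cost_mul hD aP areg inth).
rewrite -/(innerQ T (cost_along D b) h) -/(innerQ T (cost_along D a) h).
rewrite !running_costE// -!EFinM -EFinD /Delta mul1r mulN1r => <-.
by congr integral; apply/funext => z; congr EFin; ring.
Qed.

Let intP h : density_evolution T h ->
  (lebQ R d).-integrable (cyl d T) (EFin \o h).
Proof. exact: density_evolution_integrable. Qed.

Let int_diff f g : density_evolution T f -> density_evolution T g ->
  (lebQ R d).-integrable (cyl d T) (EFin \o (fun z => 1 * f z + (- 1) * g z)).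
Proof.
move=> fP gP; apply: (@integrable_lincomb _ _ R (lebQ R d)); try exact: intP.
exact: measurable_cyl.
Qed.

(** Since [b - a = delta (u - a)], the monotonicity integral for [b] and [a] is [delta] times this
    quantity. Division requires [delta != 0]; otherwise [b = a]. *)
Lemma step_monotone : 0 <= Delta u - Delta a.
Proof.
have [delta0|deltan0] := eqVneq delta 0.
  have ba : b = a.
    by rewrite bE; apply/funext => z; rewrite delta0 subr0 mul1r mul0r addr0.
  by rewrite /Delta ba !subrr.
have := coupling_monotone_Q hD bP aP breg areg mono.
have baE z : b z - a z = delta * u z + (- delta) * a z by rewrite bE; ring.
under eq_integral do rewrite baE.
rewrite Delta_integral; last first.
  apply: (@integrable_lincomb _ _ R (lebQ R d)); try exact: intP.
  exact: measurable_cyl.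
rewrite lee_fin /Delta !running_cost_lincomb//; try exact: intP.
rewrite (_ : _ - _ = delta * (running_cost b u - running_cost a u
  - (running_cost b a - running_cost a a))); last by ring.
by rewrite pmulr_rge0// lt_def deltan0; case/andP: delta01.
Qed.

(** Young's inequality with weight [lam] pairs [f(b) - f(a)] with [u - w]. The first square is
    bounded through [b - a = - delta (a - u)]; the second gives [lam * X / 2], which [step_growth_w]
    will cancel. *)
Lemma step_lipschitz :
  Delta u - Delta w <= Lf ^+ 2 * delta ^+ 2 * Y / (2 * lam) + lam * X / 2.
Proof.
have mC := @measurable_cyl R d T.
have [_ normY _] := conv_au; have [_ normX _] := conv_uw.
have YE := normQ_square normY; have XE := normQ_square normX.
have baE z : b z - a z = - delta * (a z - u z) by rewrite bE; ring.
have ba2 : (\int[lebQ R d]_(z in cyl d T) ((b z - a z) ^+ 2)%:E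
    = (delta ^+ 2 * Y)%:E)%E.
  rewrite EFinM /Y -YE -(@ge0_integralZl_EFin _ _ R (lebQ R d) _ mC)//.
  - by congr integral; apply/funext => z; rewrite baE exprMn sqrrN EFinM.
  - by move=> z _; rewrite lee_fin sqr_ge0.
  - apply/measurable_EFinP; apply: measurable_funX.
    exact: measurable_evolution_diff aP uP.
  - exact: sqr_ge0.
have lipQ := coupling_lipschitz_Q hD bP aP breg areg lip.
rewrite ba2 ltry in lipQ; have {}lipQ := lipQ isT.
have dc2 := @integrable_square _ _ R (lebQ R d) _ _ mC
  (measurable_cost_diff hD bP aP breg areg) (le_lt_trans lipQ (ltry _)).
have uw2 := @integrable_square _ _ R (lebQ R d) _ _ mC
  (measurable_evolution_diff uP wP).
rewrite XE ltry in uw2; have {}uw2 := uw2 isT.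
have uwint : (lebQ R d).-integrable (cyl d T) (EFin \o (fun z => u z - w z)).
  have := int_diff uP wP; apply: eq_integrable => // z _.
  by rewrite /= mul1r mulN1r.
have young := @integral_young _ _ R (lebQ R d) _ _ _ lam mC lam0
  (integrable_cost_diff_mul hD bP aP breg areg uwint) dc2 uw2.
rewrite XE Delta_integral// in young.
have DeltaB : Delta (fun z => u z - w z) = Delta u - Delta w.
  rewrite /Delta (_ : (fun z => u z - w z) = (fun z => 1 * u z + (- 1) * w z)).
    by rewrite !running_cost_lincomb//; try exact: intP; ring.
  by apply/funext => z; rewrite mul1r mulN1r.
rewrite -DeltaB -lee_fin; apply: le_trans young _.
rewrite EFinD; apply: leeD; last first.
  by rewrite -EFinM lee_fin /X; lra.
apply: (@le_trans _ _ ((lam^-1 / 2)%:E * (Lf ^+ 2 * (delta ^+ 2 * Y))%:E)%E).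
  apply: lee_wpmul2l; last by rewrite EFinM.
  by rewrite lee_fin divr_ge0// invr_ge0 ltW.
rewrite -EFinM lee_fin le_eqVlt; apply/orP; left; apply/eqP.
by field; rewrite gt_eqF.
Qed.

(** Besides the convexity bound, this gives finiteness of the dynamic cost at the next iterate,
    which then propagates along the play. *)
Lemma step_dynamic_cost : exists2 Rb, dynamic_cost D b mb = Rb%:E &
  Rb <= (1 - delta) * Ra + delta * Ru.
Proof.
have [c cE le_c] := directional_interp conv_au aC uC aR uR delta01.
exists c; first by rewrite bE mbE.
apply: le_trans le_c _; rewrite gerBl; case/andP: delta01 => d0 d1.
rewrite -mulrA mulr_ge0//; last by rewrite mulr_ge0 ?subr_ge0.
by rewrite divr_ge0// mulr_ge0 ?sqr_ge0// ltW.
Qed.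

Lemma step_gain Rb : dynamic_cost D b mb = Rb%:E ->
  let ga := Ra + linear_cost a a - (Ru + linear_cost a u) in
  let gb := Rb + linear_cost b b - (Rw + linear_cost b w) in
  0 <= ga /\ gb <= (1 - delta + Lf ^+ 2 / lam ^+ 2 * delta ^+ 2) * ga.
Proof.
move=> bR ga gb.
have le_b : Rb <= (1 - delta) * Ra + delta * Ru.
  by have [c cE] := step_dynamic_cost; move: cE; rewrite bR => -[->].
have grow_a := step_growth_a; have grow_w := step_growth_w.
have lipXY := step_lipschitz; have mono_u := step_monotone.
have Y0 : 0 <= Y by exact: sqr_ge0.
have ga0 : lam * Y / 2 <= ga by rewrite /ga; lra.
split; first by apply: le_trans ga0; rewrite divr_ge0// mulr_ge0// ltW.
have bb : linear_cost b b = (1 - delta) * linear_cost b a + delta * linear_cost b u.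
  by rewrite -(linear_cost_convex bP breg delta01 aP uP) -bE.
(* [ga0] converts the squared distance [Y] into gain. *)
have Yle : Lf ^+ 2 * delta ^+ 2 * Y / (2 * lam) <= Lf ^+ 2 / lam ^+ 2 * delta ^+ 2 * ga.
  rewrite (_ : Lf ^+ 2 * delta ^+ 2 * Y / (2 * lam) =
    Lf ^+ 2 / lam ^+ 2 * delta ^+ 2 * (lam * Y / 2)).
    by rewrite ler_wpM2l// mulr_ge0 ?divr_ge0 ?sqr_ge0.
  by field; rewrite gt_eqF.
have mono' : 0 <= (1 - delta) * (Delta u - Delta a).
  by rewrite mulr_ge0// subr_ge0; case/andP: delta01.
(* The term [(1 - delta) * ga] comes from convexity at [b], its coupling part having the right sign
   by [mono']. The rest is [J(u; b) - J(w; b)], in which the terms in [X] cancel. *)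
apply: (@le_trans _ _ ((1 - delta) * ga
    + Lf ^+ 2 * delta ^+ 2 * Y / (2 * lam))); last by lra.
rewrite /gb bb; move: le_b mono' lipXY grow_w; rewrite /ga /Delta /linear_cost.
lra.
Qed.

End step.

End game.

(* [dynamic_cost] may be infinite, and [+oo - +oo = -oo] in the definition of
   [gain]: the first case occurs when no admissible pair has finite cost, the
   second one when some has, but the initial one does not. *)
Lemma fictitious_play_gain (R : realType) (d : nat) (D : mfg R d)
    (delta : nat -> R) (rho rhoh : nat -> 'rV[R]_d * R -> R)
    (m mh : nat -> 'rV[R]_d * R -> 'rV[R]_d) (Lf lam : R) :
  standing_assumptions D -> constraint D (rho 0%N) (m 0%N) ->
  (forall k, (1 <= k)%N -> 0 <= delta k <= 1) ->
  (forall k, regular_evolution D (rho k)) ->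
  fictitious_play D delta rho rhoh m mh ->
  coupling_lipschitz Lf (cost D) -> coupling_independent (costT D) ->
  coupling_monotone (cost D) -> 0 < lam ->
  (forall k, (1 <= k)%N ->
     directional_strongly_convex D lam (rhoh k) (mh k) (rhoh k.+1) (mh k.+1)) ->
  (forall k,
     directional_strongly_convex D lam (rho k) (m k) (rhoh k.+1) (mh k.+1)) ->
  [\/ forall k, gain D (rho k) (m k) = -oo%E,
      gain D (rho 0%N) (m 0%N) = +oo%E |
      exists2 G : nat -> R, forall k, gain D (rho k) (m k) = (G k)%:E /\ 0 <= G k &
        forall k, G k.+1 <=
          (1 - delta k.+1 + Lf ^+ 2 / lam ^+ 2 * delta k.+1 ^+ 2) * G k].
Proof.
move=> hD h0 hdelta hreg hplay hLip hT hmono hlam hconv1 hconv2.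
have [psi [mpsi [M psiM] costTE]] := terminal_cost hD hT.
have hmin k : minimizer D (rhoh k.+1) (mh k.+1) (rho k).
  by have [[]] := hplay k.+1 isT.
have rhoE k : rho k.+1 = (fun z => (1 - delta k.+1) * rho k z + delta k.+1 * rhoh k.+1 z).
  by have [_ rhoE _] := hplay k.+1 isT; apply/funext.
have mE k : m k.+1 = (fun z => (1 - delta k.+1) *: m k z + delta k.+1 *: mh k.+1 z).
  by have [_ _ mE] := hplay k.+1 isT; apply/funext.
have rhohC k : constraint D (rhoh k.+1) (mh k.+1) by case: (hmin k).
have rhoC k : constraint D (rho k) (m k).
  elim: k => [//|k IH]; rewrite rhoE mE.
  by apply: constraint_convex => //; exact: hdelta.
have rhoP k : density_evolution (horizon D) (rho k) by case: (rhoC k).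
have rhohP k : density_evolution (horizon D) (rhoh k.+1) by case: (rhohC k).
pose l r h := linear_cost D psi r h.
have JkE k r' m' : constraint D r' m' ->
    J D r' m' (rho k) = (dynamic_cost D r' m' + (l (rho k) r')%:E)%E.
  by move=> [r'P _ _ _]; apply: (JE hD mpsi psiM costTE).
have gainE k : gain D (rho k) (m k) =
    (dynamic_cost D (rho k) (m k) + (l (rho k) (rho k))%:E -
     (dynamic_cost D (rhoh k.+1) (mh k.+1) + (l (rho k) (rhoh k.+1))%:E))%E.
  by rewrite (gain_minimizer _ (hmin k)) !JkE.
have cost_fin r' m' : constraint D r' m' -> (dynamic_cost D r' m' != +oo)%E ->
    dynamic_cost D r' m' = (fine (dynamic_cost D r' m'))%:E.
  move=> [r'P _ _ _] noty; rewrite fineK// fin_numE noty andbT.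
  by rewrite gt_eqF// dynamic_cost_gtNy.
have [[r' [m' [C' fin']]]|allinf] := pselect (exists r' m',
    constraint D r' m' /\ (dynamic_cost D r' m' != +oo)%E); last first.
  apply: Or31 => k; rewrite gainE.
  have infty r' m' : constraint D r' m' -> dynamic_cost D r' m' = +oo%E.
    by move=> C'; apply: contrapT => /eqP fin'; apply: allinf; exists r', m'.
  by rewrite !infty.
(* A best response costs no more than the admissible pair of finite cost, so its own cost is
   finite. *)
have hat_fin k : (dynamic_cost D (rhoh k.+1) (mh k.+1) != +oo)%E.
  have [_ /(_ _ _ C')] := hmin k; rewrite !JkE// (cost_fin _ _ C' fin').
  by apply: contraTneq => ->.
pose Rh k := fine (dynamic_cost D (rhoh k.+1) (mh k.+1)).
have RhE k : dynamic_cost D (rhoh k.+1) (mh k.+1) = (Rh k)%:E by exact: cost_fin.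
have [inf0|fin0] := eqVneq (dynamic_cost D (rho 0%N) (m 0%N)) +oo%E.
  by apply: Or32; rewrite gainE inf0 RhE.
have rho_fin k : dynamic_cost D (rho k) (m k) = (fine (dynamic_cost D (rho k) (m k)))%:E.
  elim: k => [|k IH]; first exact: cost_fin.
  have [c cE _] := step_dynamic_cost hD hlam (hdelta k.+1 isT) (rhoC k) (hmin k)
    (rhoE k) (mE k) (hconv2 k) IH (RhE k).
  by rewrite cE.
pose G k := fine (dynamic_cost D (rho k) (m k)) + l (rho k) (rho k)
  - (Rh k + l (rho k) (rhoh k.+1)).
have step k : 0 <= G k /\
    G k.+1 <= (1 - delta k.+1 + Lf ^+ 2 / lam ^+ 2 * delta k.+1 ^+ 2) * G k.
  exact: (step_gain hD mpsi psiM costTE hlam (hdelta k.+1 isT) (rhoC k) (hreg k)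
    (hreg k.+1) (hmin k) (hmin k.+1) (rhoE k) (mE k) (hconv2 k)
    (hconv1 k.+1 isT) hLip hmono (rho_fin k) (RhE k) (RhE k.+1) (rho_fin k.+1)).
apply: Or33; exists G => k; last by case: (step k).
split; last by case: (step k).
by rewrite gainE rho_fin RhE -!EFinD.
Qed.

(** * The scalar recursion and its rates *)

(** Each factor is at most [expR (c * delta k ^+ 2 - delta k)] by [1 + x <= expR x], after enlarging
    [c / 2] to [c]. *)
Lemma gain_sum_bound (R : realType) (c : R) (delta G : nat -> R) K :
  0 <= c -> (forall k, 0 <= G k) ->
  (forall k, G k.+1 <= (1 - delta k.+1 + c / 2 * delta k.+1 ^+ 2) * G k) ->
  G K <= expR (\sum_(1 <= k < K.+1) (c * delta k ^+ 2 - delta k)) * G 0%N.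
Proof.
move=> c0 G0 Gstep; elim: K => [|K IH].
  by rewrite big_nil expR0 mul1r.
rewrite big_nat_recr//= expRD -mulrA mulrCA.
set e := expR (c * _ - _); have e1 : 1 + (c * delta K.+1 ^+ 2 - delta K.+1) <= e.
  exact: expR_ge1Dx.
have sq : 0 <= c / 2 * delta K.+1 ^+ 2 by rewrite mulr_ge0 ?sqr_ge0// divr_ge0.
apply: (le_trans (Gstep K)); apply: (@le_trans _ _ (e * G K)).
  by apply: ler_wpM2r => //; lra.
by apply: ler_wpM2l; [exact: expR_ge0|exact: IH].
Qed.

(* [alpha ^ 2 / (k + alpha) ^ 2] telescopes and
   [ln (1 + 1 / (k + alpha)) <= 1 / (k + alpha)]. *)
Lemma harmonic_sum_bound (R : realType) (c alpha : R) (delta : nat -> R) K :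
  0 <= c -> 0 < alpha ->
  (forall k, (1 <= k)%N -> delta k = alpha / (k%:R + alpha)) ->
  \sum_(1 <= k < K.+1) (c * delta k ^+ 2 - delta k) <=
  c * (alpha - alpha ^+ 2 / (K%:R + alpha)) + alpha * ln (alpha + 1)
    - alpha * ln (K%:R + alpha + 1).
Proof.
move=> c0 a0 deltaE; elim: K => [|K IH].
  rewrite big_nil add0r expr2 mulfK ?gt_eqF// subrr mulr0 add0r subrr.
  exact: lexx.
rewrite big_nat_recr//= deltaE//.
set t : R := K%:R + alpha; have t0 : 0 < t by rewrite ltr_wpDl.
rewrite -/t in IH.
have -> : K.+1%:R + alpha = t + 1 by rewrite -natr1 /t; ring.
have ln_le : ln (t + 1 + 1) - ln (t + 1) <= (t + 1)^-1.
  have t1 : 0 < t + 1 by lra.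
  rewrite -ln_div ?posrE//; last by lra.
  rewrite (_ : (t + 1 + 1) / (t + 1) = 1 + (t + 1)^-1); last first.
    by field; rewrite gt_eqF.
  have inv0 : 0 < (t + 1)^-1 by rewrite invr_gt0.
  by apply: le_ln1Dx; lra.
have sq_le : c * (alpha / (t + 1)) ^+ 2 <=
    c * (alpha ^+ 2 / t - alpha ^+ 2 / (t + 1)).
  rewrite ler_wpM2l//.
  (* [1 / (t + 1) ^+ 2] is at most [1 / (t * (t + 1))], which is the difference of [1 / t] and
     [1 / (t + 1)]. *)
  rewrite (_ : alpha ^+ 2 / t - alpha ^+ 2 / (t + 1) = alpha ^+ 2 / (t * (t + 1))).
    rewrite expr_div_n ler_wpM2l ?sqr_ge0// lef_pV2 ?posrE; first by nra.
      by rewrite exprn_gt0//; lra.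
    by rewrite mulr_gt0//; lra.
  by field; rewrite !gt_eqF//; lra.
have ln_le' : alpha * (ln (t + 1 + 1) - ln (t + 1)) <= alpha / (t + 1).
  by rewrite ler_wpM2l// ltW.
lra.
Qed.


(** * The three bounds on the gain *)

Theorem theorem3p19 (R : realType) (d : nat) (D : mfg R d)
    (hD : standing_assumptions D)
    (delta : nat -> R)
    (rho rhoh : nat -> 'rV[R]_d * R -> R)
    (m mh : nat -> 'rV[R]_d * R -> 'rV[R]_d)
    (Lf lam : R)
    (h0 : constraint D (rho 0%N) (m 0%N))
    (hdelta : forall k, (1 <= k)%N -> 0 <= delta k <= 1)
    (hreg : forall k, regular_evolution D (rho k))
    (hplay : fictitious_play D delta rho rhoh m mh)
    (hLip : coupling_lipschitz Lf (cost D))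
    (hT : coupling_independent (costT D))
    (hmono : coupling_monotone (cost D))
    (hlam : 0 < lam)
    (hconv1 : forall k, (1 <= k)%N ->
       directional_strongly_convex D lam (rhoh k) (mh k) (rhoh k.+1) (mh k.+1))
    (hconv2 : forall k,
       directional_strongly_convex D lam (rho k) (m k) (rhoh k.+1) (mh k.+1)) :
  let c := 2 * Lf ^+ 2 / lam ^+ 2 in
  let g := fun k => gain D (rho k) (m k) in
  [/\ forall K, (1 <= K)%N ->
        (g K <= (expR (\sum_(1 <= k < K.+1) (c * delta k ^+ 2 - delta k)))%:E
                * g 0%N)%E,
      forall alpha : R, 0 < alpha ->
        (forall k, (1 <= k)%N -> delta k = alpha / (k%:R + alpha)) ->
        forall K, (1 <= K)%N ->
          (g K <= g 0%N * (((alpha + 1) `^ alpha * expR (c * alpha))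
                           / ((K%:R + alpha + 1) `^ alpha))%:E)%E &
      (* [delta0 <= 1/c] is void for [c = 0], where 1/c = +oo *)
      forall delta0 : R, delta0 <= 1 -> (c != 0 -> delta0 <= c^-1) ->
        (forall k, (1 <= k)%N -> delta k = delta0) ->
        forall K, (1 <= K)%N ->
          (g K <= (expR (- (delta0 * (1 - c * delta0) * K%:R)))%:E * g 0%N)%E].
Proof.
move=> c g.
have c0 : 0 <= c by apply: divr_ge0; [apply: mulr_ge0|]; rewrite ?sqr_ge0.
(* The second component records the sign of [g 0], so that the factor in front of it can later be
   enlarged. Where [g 0] is [-oo], so is [g K]. *)
have sum_bound K : (g K <= (expR (\sum_(1 <= k < K.+1)
    (c * delta k ^+ 2 - delta k)))%:E * g 0%N)%E /\
    (g K = -oo \/ g 0%N = +oo \/ 0 <= g 0%N)%E.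
  have [ginf|g0inf|[G GE Gstep]] := fictitious_play_gain hD h0 hdelta hreg hplay
    hLip hT hmono hlam hconv1 hconv2.
  - by rewrite /g ginf leNye; split => //; left.
  - rewrite /g g0inf gt0_muley ?lte_fin ?expR_gt0// leey.
    by split => //; right; left.
  - have [g0E G0] := GE 0%N; have [gKE _] := GE K.
    rewrite /g g0E gKE -EFinM !lee_fin; split; last by right; right.
    apply: gain_sum_bound => // k; first by have [] := GE k.
    by rewrite (_ : c / 2 = Lf ^+ 2 / lam ^+ 2)// /c; field; rewrite gt_eqF.
split=> [K _|alpha a0 deltaE K K1|delta0 _ _ deltaE K K1].
- by have [] := sum_bound K.
- have [le_sum [->|[->|g0]]] := sum_bound K; first by rewrite leNye.
    rewrite gt0_mulye ?leey// lte_fin divr_gt0 ?mulr_gt0 ?powR_gt0 ?expR_gt0//.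
      by lra.
    by rewrite ltr_wpDl// addr_ge0// ltW.
  apply: (le_trans le_sum); rewrite muleC; apply: lee_wpmul2l => //.
  have Ka0 : 0 < K%:R + alpha by rewrite ltr_wpDl.
  have a1 : alpha + 1 != 0 by rewrite gt_eqF//; lra.
  have Ka1 : K%:R + alpha + 1 != 0 by rewrite gt_eqF//; lra.
  (* Powers of nonzero bases unfold to [expR (alpha * ln _)], so only exponents are compared; the
     term in [alpha ^+ 2 / (K%:R + alpha)] left by [harmonic_sum_bound] is dropped by its sign. *)
  rewrite lee_fin /powR (negbTE a1) (negbTE Ka1) -expRN -!expRD ler_expR.
  apply: (le_trans (harmonic_sum_bound K c0 a0 deltaE)).
  have : 0 <= c * (alpha ^+ 2 / (K%:R + alpha)).
    by rewrite mulr_ge0// divr_ge0 ?sqr_ge0// ltW.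
  lra.
- have [+ _] := sum_bound K.
  rewrite (_ : \sum_(1 <= k < K.+1) _ = - (delta0 * (1 - c * delta0) * K%:R))//.
  rewrite (eq_big_nat _ _ (F2 := fun=> c * delta0 ^+ 2 - delta0)); last first.
    by move=> k /andP[k1 _]; rewrite deltaE.
  by rewrite sumr_const_nat subn1 /= -[LHS]mulr_natr; ring.
Qed.
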